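(* In the annotation model, for weighted graph streams with $n$ nodes and $m$ edges, there is a valid $(m,1)$ protocol to find a minimum cost spanning tree; a valid $(m+n\log n,1)$ protocol to verify single-source shortest paths; and a valid $(n^3,1)$ protocol to verify all-pairs shortest paths.
   Context: Annotation model: a data stream $\mathcal{A}$ of length $m$ is observed by a probabilistic verifier $\mathcal{V}$ (private random string, $w(m)$ machine words of working memory, each word $\Theta(\log m)$ bits) and a deterministic helper $\mathcal{H}$. After the stream ends, $\mathcal{H}$ sends an annotation that $\mathcal{V}$ reads as a stream. $\mathcal{V}$ outputs a value (or accepts) or outputs $\perp$. A helper is valid for $\mathcal{A}$ if $\mathcal{V}$ outputs the correct answer (respectively accepts) with probability 1; it is $\tfrac13$-invalid for $\mathcal{A}$ if $\mathcal{V}$ outputs something other than $\perp$ with probability at most $1/3$. A protocol is valid if some helper is valid for every $\mathcal{A}$, and for every helper and every stream, the helper is either valid or $\tfrac13$-invalid. Help cost: maximum annotation length of a shortest valid helper; verification cost: $w(m)$ (in words). An $(h,v)$ protocol is a valid protocol with help cost $O(h+1)$ and verification cost $O(v+1)$. Weighted graph stream: items $(u,v,w)\in[n]\times[n]\times\mathbb{Z}_+$.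
   Formalization: Node count and edge weights are taken to be at most a polynomial (m+2)^c of any fixed degree, so that they fit in O(1) words of Θ(log m) bits (constants depend on c); the all-pairs claim is stated for m ≤ n², i.e. graphs without repeated edges. *)

(* Defs.v *)
From mathcomp Require Import all_boot all_order all_algebra.
From mathcomp Require Import boolp.

Set Implicit Arguments.
Unset Strict Implicit.
Unset Printing Implicit Defensive.

(* Word length for streams of length m.  The "m + 2" keeps it positive;
   constant factors in the word length are absorbed by the O(.) of the costs. *)
Definition word_bits (m : nat) : nat := up_log 2 (m + 2).

Definition word (m : nat) : Type := (word_bits m).-tuple bool.

(* A verifier for streams of length m with items in I.  The transition functions
   are arbitrary: only the working memory kept between two reads is charged.
   The verifier knows m and where the stream and the annotation end.
   The random string is not part of the memory, and is never revealed to the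
   helper.  Answers such as spanning trees do not fit in the memory, so the
   verifier also has a write-only output tape with symbols in O: each read
   appends a (possibly empty) sequence to it.  At the end the verifier either
   disowns the tape, outputting ⊥ ([finish] returns [None]), or completes it. *)
Record verifier (m : nat) (I O : Type) := Verifier {
  coins : nat;
  memory_words : nat;
  random_string := coins.-tuple bool;
  memory := memory_words.-tuple (word m);
  init : random_string -> memory;
  read_item : random_string -> memory -> I -> memory * seq O;
  read_word : random_string -> memory -> word m -> memory * seq O;
  finish : random_string -> memory -> option (seq O)
}.

Section Model.

Variables (m : nat) (I O : Type).
Implicit Types (V : verifier m I O) (A : m.-tuple I) (a : seq (word m)).

Fixpoint run (M T : Type) (step : M -> T -> M * seq O) (s : M) (xs : seq T) :
    M * seq O :=
  if xs is x :: xs' then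
    let: (s1, o1) := step s x in
    let: (s2, o2) := run step s1 xs' in (s2, o1 ++ o2)
  else (s, [::]).

(* [None] is the output ⊥. *)
Definition output V (r : random_string V) A a : option (seq O) :=
  let: (s1, o1) := run (read_item r) (init r) A in
  let: (s2, o2) := run (read_word r) s1 a in
  omap (fun o3 => o1 ++ o2 ++ o3) (finish r s2).

Definition prob (k : nat) (E : k.-tuple bool -> Prop) : rat :=
  (#|[set r | `[< E r >]]|%:R / (2 ^ k)%:R)%R.

(* Helpers are deterministic. *)
Definition helper := m.-tuple I -> seq (word m).

(* A problem is the relation "o is a correct answer on A"; an instance may have
   several correct answers (ties between spanning trees) or none. *)
Definition problem := m.-tuple I -> seq O -> Prop.

Implicit Types (f : problem) (H : helper).

Definition valid_for V f H A : Prop :=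
  prob (fun r : random_string V =>
          exists2 o, output r A (H A) = Some o & f A o) = 1%R.

Definition invalid_for V (delta : rat) H A : Prop :=
  (prob (fun r : random_string V => output r A (H A) <> None) <= delta)%R.

(* Validity is asked where a correct answer exists.  On the other streams no
   helper is valid, so [valid_protocol] makes every helper 1/3-invalid there. *)
Definition valid_helper V f H : Prop :=
  forall A, (exists o, f A o) -> valid_for V f H A.

Definition valid_protocol V f : Prop :=
  (exists H, valid_helper V f H) /\
  (forall H A, valid_for V f H A \/ invalid_for V (1%:R / 3%:R)%R H A).

Definition shortest_valid_helper V f H : Prop :=
  valid_helper V f H /\
  forall H', valid_helper V f H' -> forall A, size (H A) <= size (H' A).

Definition help_cost_le V f (k : nat) : Prop :=
  exists2 H, shortest_valid_helper V f H & forall A, size (H A) <= k.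

(* An (h, v) protocol, with C the constant of both O(h + 1) and O(v + 1). *)
Definition hv_protocol (C : nat) V f (h v : nat) : Prop :=
  [/\ valid_protocol V f,
      help_cost_le V f (C * (h + 1)) &
      memory_words V <= C * (v + 1)].

End Model.

(* (u, v, i) is the edge between u and v of weight i + 1, so that the weights
   are exactly the integers 1, ..., W. *)
Definition edge (n W : nat) : Type := ('I_n * 'I_n * 'I_W)%type.

Section Graphs.

Variables n W : nat.
Implicit Types (e : edge n W) (E T : seq (edge n W)) (u v s x : 'I_n).

Definition source e : 'I_n := e.1.1.
Definition target e : 'I_n := e.1.2.
Definition weight e : nat := e.2.+1.

(* e can be traversed from u to v; if [directed] is false, both ways. *)
Definition traverses (directed : bool) e u v : bool :=
  ((source e == u) && (target e == v)) ||
  (~~ directed && (source e == v) && (target e == u)).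

Definition adjacent E : rel 'I_n :=
  fun u v => has (fun e => traverses false e u v) E.

(* No loops and no parallel edges. *)
Definition simple E : Prop :=
  all (fun e => source e != target e) E /\
  uniq [seq [set source e; target e] | e <- E].

Definition acyclic E : Prop :=
  forall p : seq 'I_n, ucycle (adjacent E) p -> size p <= 2.

Definition spanning_tree E T : Prop :=
  [/\ {subset T <= E}, simple T, acyclic T &
      forall u v, connect (adjacent T) u v].

Definition cost T : nat := \sum_(e <- T) weight e.

Definition min_spanning_tree E T : Prop :=
  spanning_tree E T /\
  forall T', spanning_tree E T' -> cost T <= cost T'.

Definition mst_problem (m : nat) : problem m (edge n W) (edge n W) :=
  fun A T => min_spanning_tree A T.

Inductive path_length (directed : bool) E (s : 'I_n) : 'I_n -> nat -> Prop :=
| path_nil : path_length directed E s s 0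
| path_step x v e d :
    path_length directed E s x d -> e \in E -> traverses directed e x v ->
    path_length directed E s v (d + weight e).

Definition distance (directed : bool) E s v (d : nat) : Prop :=
  path_length directed E s v d /\
  forall d', path_length directed E s v d' -> d <= d'.

(* What is stated about a target v: [None] if v is unreachable, and otherwise
   its distance and its predecessor on a shortest path ([None] for the path
   without edges). *)
Definition sp_entry : Type := option (nat * option 'I_n).

Definition correct_entry (directed : bool) E s v (t : sp_entry) : Prop :=
  match t with
  | None => forall d, ~ path_length directed E s v d
  | Some (d, None) => v = s /\ distance directed E s v d
  | Some (d, Some x) =>
      distance directed E s v d /\
      exists e d', [/\ path_length directed E s x d', e \in E,
                       traverses directed e x v & d = d' + weight e]
  end.

(* The claimed solution, listed on the output tape in the order of the nodes. *)
Definition sssp_problem (directed : bool) (m : nat) (s : 'I_n) :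
    problem m (edge n W) sp_entry :=
  fun A o => exists2 t : 'I_n -> sp_entry,
    o = [seq t v | v <- enum 'I_n] &
    forall v, correct_entry directed A s v (t v).

Definition apsp_problem (directed : bool) (m : nat) :
    problem m (edge n W) sp_entry :=
  fun A o => exists2 t : 'I_n -> 'I_n -> sp_entry,
    o = [seq t s v | s <- enum 'I_n, v <- enum 'I_n] &
    forall s v, correct_entry directed A s v (t s v).

End Graphs.

(* Quantities polynomial in m: those that fit in a constant number of words. *)
Definition poly_bound (c m : nat) : nat := (m + 2) ^ c.

(* Main.v *)
(** The verifier is allowed a free random function R on an arbitrary finite type,
    so it can compare two streamed multisets by the sums of their R-values: unequal
    multisets collide with probability at most 1/4. Hence an annotation may claim
    facts in any order and look them up later any number of times: each letter
    provides one fact together with the number of its later uses, and a single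
    comparison checks that every fact looked up was provided and that the edges
    listed in the annotation are exactly those of the stream.

    For shortest paths, the annotation gives a distance and a predecessor to every
    node and repeats every edge with the distances of its ends, so that the verifier
    sees that no edge can be relaxed and that every distance is attained.

    For spanning trees, Kruskal's algorithm defines a binary tree of merges. Listing
    its leaves from left to right turns every merged component into an interval of
    positions, described by O(1) numbers, and the heaviest tree edge between two
    nodes is the top edge of an interval around their positions. So O(1) words per
    edge certify that no input edge is lighter than the tree path between its ends,
    which is equivalent to minimality. *)

Require Import Defs.
From mathcomp Require Import all_boot all_order all_algebra.
From mathcomp Require Import boolp zify.

Set Implicit Arguments.
Unset Strict Implicit.
Unset Printing Implicit Defensive.

(** * Randomised multiset comparison *)

Lemma inj_finType_exists (S T : finType) :
  #|S| <= #|T| -> exists g : S -> T, injective g.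
Proof.
move=> leST; exists (fun x => enum_val (widen_ord leST (enum_rank x))).
by move=> x y /enum_val_inj /(congr1 val) /= /ord_inj/enum_rank_inj.
Qed.

Section RandomFunctions.

Variable Z : finType.
Implicit Types (R : {ffun Z -> 'I_4}) (s t : seq Z).

(** Four values per element keep the collision probability at 1/4, below the allowed 1/3, and cost
    exactly two coins each. The sum is a plain natural number, kept polynomial by [hash_le]. *)
Definition hash R s : nat := \sum_(z <- s) R z.

Lemma hash_cat R s t : hash R (s ++ t) = hash R s + hash R t.
Proof. exact: big_cat. Qed.

Lemma hash_le R s : hash R s <= 3 * size s.
Proof.
rewrite mulnC -sum1_size big_distrl /=; apply: leq_sum => z _.
by have := ltn_ord (R z); lia.
Qed.

Lemma perm_hash R s t : perm_eq s t -> hash R s = hash R t.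
Proof. exact: perm_big. Qed.

Lemma hash_count R s z :
  hash R s = count_mem z s * R z + \sum_(y <- s | y != z) R y.
Proof.
rewrite /hash (bigID (fun y => y == z)) /=; congr (_ + _).
rewrite -sum1_count big_distrl /=; apply: eq_bigr => y /eqP ->.
by rewrite mul1n.
Qed.

(* If z does not occur equally often in s and t, a collision determines R z from the
   other values of R; so overwriting R z with all four values spreads the
   collisions over disjoint sets of four functions. *)
Lemma card_hash_collision s t :
  ~~ perm_eq s t ->
  4 * #|[set R | hash R s == hash R t]| <= #|{: {ffun Z -> 'I_4}}|.
Proof.
move=> /allPn /= [z _ neq_z]; set E := [set R | _].
pose put R (j : 'I_4) : {ffun Z -> 'I_4} :=
  [ffun y => if y == z then j else R y].
have put_inj : {in setX E [set: 'I_4] &, injective (fun x => put x.1 x.2)}.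
  move=> [R1 j1] [R2 j2]; rewrite !inE !andbT /= => /eqP c1 /eqP c2 eq_put.
  have eq_j : j1 = j2 by have /ffunP/(_ z) := eq_put; rewrite !ffunE eqxx.
  have eq_off y : y != z -> R1 y = R2 y.
    by have /ffunP/(_ y) := eq_put; rewrite !ffunE => + /negPf neq; rewrite neq.
  have sum_off r : \sum_(y <- r | y != z) R1 y = \sum_(y <- r | y != z) R2 y.
    by apply: eq_bigr => y /eq_off ->.
  suff eq_z : R1 z = R2 z.
    congr (_, _) => //; apply/ffunP => y.
    by have [->|/eq_off] := eqVneq y z.
  apply/val_inj/eqP; move: c1 c2 neq_z.
  rewrite !(hash_count _ _ z) !sum_off /=.
  by set x1 : nat := R1 z; set x2 : nat := R2 z; nia.
have := max_card [set put x.1 x.2 | x in setX E [set: 'I_4]].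
by rewrite card_in_imset // cardsX cardsT card_ord mulnC.
Qed.

End RandomFunctions.

(** Both sides have 4^|Z| elements. Injectivity is what lets a bound on the number of bad functions
    bound the number of bad coin strings. *)
Lemma random_function_of_coins (Z : finType) :
  exists rnd : (2 * #|Z|).-tuple bool -> {ffun Z -> 'I_4}, injective rnd.
Proof.
by apply: inj_finType_exists; rewrite card_tuple card_bool card_ffun card_ord expnM.
Qed.

Lemma prob_eq1 (k : nat) (E : k.-tuple bool -> Prop) :
  (forall r, E r) -> prob E = 1%R.
Proof.
move=> Er; rewrite /prob.
have -> : [set r | `[< E r >]] = setT.
  by apply/setP => r; rewrite !inE; apply/asboolP.
by rewrite cardsT card_tuple card_bool GRing.divff // Num.Theory.pnatr_eq0 expn_eq0.
Qed.

Lemma prob_le_third (k : nat) (E : k.-tuple bool -> Prop) (F : {set k.-tuple bool}) :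
  (forall r, E r -> r \in F) -> 3 * #|F| <= 2 ^ k ->
  (prob E <= 1%:R / 3%:R)%R.
Proof.
move=> EF leF; rewrite /prob.
rewrite Num.Theory.ler_pdivrMr ?Num.Theory.ltr0n ?expn_gt0 //.
rewrite GRing.mulrAC Num.Theory.ler_pdivlMr ?Num.Theory.ltr0n //.
rewrite GRing.mul1r -GRing.natrM Num.Theory.ler_nat mulnC.
apply: leq_trans leF; rewrite leq_mul2l /=; apply: subset_leq_card.
by apply/subsetP => r; rewrite inE => /asboolP; apply: EF.
Qed.

Lemma prob_collision_le_third (Z : finType) (s t : seq Z)
    (rnd : (2 * #|Z|).-tuple bool -> {ffun Z -> 'I_4}) :
  injective rnd -> ~~ perm_eq s t ->
  3 * #|[set r | hash (rnd r) s == hash (rnd r) t]| <= 2 ^ (2 * #|Z|).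
Proof.
move=> rnd_inj /card_hash_collision.
rewrite card_ffun card_ord -(expnM 2 2); apply: leq_trans.
apply: leq_mul => //; rewrite -(card_imset _ rnd_inj).
apply: subset_leq_card; apply/subsetP => R /imsetP[r].
by rewrite !inE => ? ->.
Qed.

Lemma run_cat (M T O : Type) (step : M -> T -> M * seq O) s xs ys :
  run step s (xs ++ ys) =
  let: (s1, o1) := run step s xs in
  let: (s2, o2) := run step s1 ys in (s2, o1 ++ o2).
Proof.
elim: xs s => [|x xs IHxs] s /=; first by case: run.
case: (step s x) => s1 o1; rewrite IHxs.
by case: (run step s1 xs) => s2 o2; case: run => s3 o3; rewrite catA.
Qed.

(** * Simulation of abstract states in machine words *)

Section CodedMemory.

Variables (m : nat) (I O T : Type) (k w : nat).
Variables (enc : T -> w.-tuple (word m)) (dec : w.-tuple (word m) -> T).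
Variable Inv : T -> Prop.
Hypothesis encK : forall t, Inv t -> dec (enc t) = t.

Definition coded_step (X : Type) (step : T -> X -> T * seq O) s x :=
  let: (t, o) := step (dec s) x in (enc t, o).

Definition coded_verifier
    (ini : k.-tuple bool -> T)
    (item : k.-tuple bool -> T -> I -> T * seq O)
    (wrd : k.-tuple bool -> T -> word m -> T * seq O)
    (fin : k.-tuple bool -> T -> option (seq O)) : verifier m I O :=
  @Verifier m I O k w (fun r => enc (ini r)) (fun r => coded_step (item r))
    (fun r => coded_step (wrd r)) (fun r s => fin r (dec s)).

(** The counters of the abstract state are unbounded naturals, so [enc] is faithful only where [Inv]
    holds; the simulation therefore carries [Inv] along the run. *)
Lemma run_coded (X : Type) (step : T -> X -> T * seq O) t xs :
  (forall t x, Inv t -> Inv (step t x).1) -> Inv t ->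
  run (coded_step step) (enc t) xs =
    (enc (run step t xs).1, (run step t xs).2) /\ Inv (run step t xs).1.
Proof.
move=> Istep; elim: xs t => [|x xs IHxs] t It //=.
rewrite /coded_step encK //; have := Istep t x It.
case: (step t x) => t1 o1 /= /IHxs[-> It1].
by case: (run step t1 xs) It1.
Qed.

Lemma output_coded ini item wrd fin r (A : m.-tuple I) a :
  (forall t x, Inv t -> Inv (item r t x).1) ->
  (forall t x, Inv t -> Inv (wrd r t x).1) -> Inv (ini r) ->
  @output _ _ _ (coded_verifier ini item wrd fin) r A a =
    let: (t1, o1) := run (item r) (ini r) A in
    let: (t2, o2) := run (wrd r) t1 a in
    omap (fun o3 => o1 ++ o2 ++ o3) (fin r t2).
Proof.
move=> Iitem Iwrd Iini; rewrite /output /=.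
have [-> ] := run_coded A Iitem Iini.
case: (run (item r) (ini r) A) => t1 o1 /= /(run_coded a Iwrd)[->].
by case: (run (wrd r) t1 a) => t2 o2 /= /encK ->.
Qed.

End CodedMemory.

(** * Letters spelled as blocks of words *)

Section Spelling.

Variables (W : eqType) (L : finType) (p : nat) (enc : L -> p.-tuple W).
Hypotheses (p_gt0 : 0 < p) (enc_inj : injective enc).
Variables (T O : Type) (step : T -> L -> T * seq O) (dead : T).
Hypothesis step_dead : forall l, step dead l = (dead, [::]).

Definition spell (ls : seq L) : seq W := flatten [seq tval (enc l) | l <- ls].

Lemma size_spell ls : size (spell ls) = p * size ls.
Proof.
rewrite size_flatten /shape -map_comp (eq_map (g := fun=> p)) => [|l] /=.
  by elim: ls => [|l ls /= ->]; rewrite ?muln0 ?mulnS.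
by rewrite size_tuple.
Qed.

(** The second component holds the words of the block not yet completed. A complete block that is no
    codeword leads to [dead], which no later letter can leave. *)
Definition buffered_step (x : T * seq W) (c : W) : T * seq W * seq O :=
  let buf := rcons x.2 c in
  if size buf < p then (x.1, buf, [::]) else
  if [pick l | tval (enc l) == buf] is Some l then
    let: (t, o) := step x.1 l in (t, [::], o)
  else (dead, [::], [::]).

Lemma run_buffered_short t buf a :
  size buf + size a < p ->
  run buffered_step (t, buf) a = (t, buf ++ a, [::]).
Proof.
elim: a buf => [|c a IHa] buf /= lt_p; first by rewrite cats0.
rewrite /buffered_step /= size_rcons ifT; last by lia.
by rewrite IHa ?size_rcons ?cat_rcons //; lia.
Qed.

Lemma run_buffered_block t a :
  size a = p ->
  run buffered_step (t, [::]) a =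
  if [pick l | tval (enc l) == a] is Some l then
    let: (t1, o) := step t l in (t1, [::], o)
  else (dead, [::], [::]).
Proof.
case/lastP: a => [|a c]; first by move=> /= p0; have := p_gt0; rewrite -{1}p0.
rewrite size_rcons => sz; rewrite -cats1 run_cat run_buffered_short ?add0n -?sz //=.
rewrite /buffered_step /= size_rcons sz ltnn cats1.
by case: pickP => [l _|_] //; case: step => t1 o; rewrite cats0.
Qed.

Lemma run_buffered_dead buf a : (run buffered_step (dead, buf) a).1.1 = dead.
Proof.
elim: a buf => //= c a IHa buf.
have : (buffered_step (dead, buf) c).1.1 = dead.
  by rewrite /buffered_step /=; case: ifP => // _; case: pickP => [l|] //;
    rewrite step_dead.
case: buffered_step => -[t1 buf1] o1 /= ->.
by have := IHa buf1; case: run.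
Qed.

Lemma run_spell t ls :
  run buffered_step (t, [::]) (spell ls) =
  let: (t1, o) := run step t ls in (t1, [::], o).
Proof.
elim: ls t => //= l ls IHls t.
rewrite /spell /= -/(spell ls) run_cat run_buffered_block ?size_tuple //.
case: pickP => [l' /eqP/val_inj/enc_inj ->|/(_ l)]; last by rewrite eqxx.
by case: step => t1 o1; rewrite IHls; case: run.
Qed.

(** Blocks of [p] words are peeled off. Either one of them is no codeword, or a remainder shorter
    than [p] is left in the buffer; it is nonempty because the empty remainder would be spelled by
    the empty list. *)
Lemma run_not_spell t a :
  (forall ls, a <> spell ls) ->
  (run buffered_step (t, [::]) a).1.1 = dead \/
  (run buffered_step (t, [::]) a).1.2 <> [::].
Proof.
have [s] := ubnP (size a); elim: s a t => // s IHs a t lt_s not_spell.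
have [lt_p|le_p] := ltnP (size a) p.
  by right; rewrite run_buffered_short //= => a0; apply: (not_spell [::]).
rewrite -(cat_take_drop p a) run_cat run_buffered_block ?size_takel //.
case: pickP => [l /eqP enc_l|_]; last first.
  by left; have := run_buffered_dead [::] (drop p a); case: run => -[].
case: (step t l) => t1 o1.
have lt_s' : size (drop p a) < s by rewrite size_drop; lia.
have not_spell' ls : drop p a <> spell ls.
  move=> eq_ls; apply: (not_spell (l :: ls)).
  by rewrite /spell /= enc_l -/(spell ls) -eq_ls cat_take_drop.
by have := IHs _ t1 lt_s' not_spell'; case: run.
Qed.

End Spelling.

(** * From annotations of single streams to helpers *)

Lemma exists_min_nat (T : Type) (P : T -> Prop) (g : T -> nat) :
  (exists x, P x) -> exists2 x, P x & forall y, P y -> g x <= g y.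
Proof.
case=> x; have [k] := ubnP (g x); elim: k x => // k IHk x lt_k Px.
have [[y Py lt_yx]|no_less] := pselect (exists2 y, P y & g y < g x).
  by apply: (IHk y) => //; lia.
exists x => // y Py; rewrite leqNgt; apply/negP => lt_yx.
by apply: no_less; exists y.
Qed.

(** Validity and length are decided stream by stream, so choosing a shortest valid annotation for
    each stream gives a helper that is shortest everywhere at once. A stream without correct answer
    gets the empty annotation. *)
Lemma hv_protocol_of_annotations m I O (V : verifier m I O) f C h v :
  (forall A a, valid_for V f (fun=> a) A \/
               invalid_for V (1%:R / 3%:R)%R (fun=> a) A) ->
  (forall A o, f A o ->
     exists2 a, valid_for V f (fun=> a) A & size a <= C * (h + 1)) ->
  memory_words V <= C * (v + 1) -> hv_protocol C V f h v.
Proof.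
move=> dichotomy annot memC.
have /choice[H HP] : forall A, exists a,
    ((exists o, f A o) -> valid_for V f (fun=> a) A /\
      forall a', valid_for V f (fun=> a') A -> size a <= size a') /\
    (~ (exists o, f A o) -> a = [::]).
  move=> A.
  have [[o fAo]|no_o] := pselect (exists o, f A o).
    have [|a va min_a] :=
      @exists_min_nat _ (fun a => valid_for V f (fun=> a) A) size.
      by have [a] := annot A o fAo; exists a.
    by exists a; split=> // [] []; exists o.
  by exists [::]; split=> // /no_o.
have validH : valid_helper V f H by move=> A /(proj1 (HP A))[].
split=> //; first by split=> [|H' A]; [exists H | exact: dichotomy A (H' A)].
exists H => [|A].
  split=> // H' validH' A; have [ex_o|no_o] := pselect (exists o, f A o).
    by have [_] := (HP A).1 ex_o; apply; apply: validH'.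
  by rewrite (HP A).2.
have [[o fAo]|no_o] := pselect (exists o, f A o); last by rewrite (HP A).2.
have [a va] := annot A o fAo; apply: leq_trans.
by have [_] := (HP A).1 (ex_intro _ o fAo); apply.
Qed.

Lemma word_card m : m + 2 <= #|{: word m}|.
Proof. by rewrite card_tuple card_bool; apply: up_logP. Qed.

(** * One-pass scanning with counters and fingerprints *)

Section Scan.

Variables (G O : Type) (J : eqType) (Z : finType).
Variables (ok : pred G) (idx : G -> option J) (order : seq J) (out : G -> seq O).
Variables (lft rgt : G -> seq Z) (b : nat) (R : {ffun Z -> 'I_4}).

(* Number of symbols read, number of order indices seen, and the hashes of the
   left and right multisets; None once the input has been rejected. *)
Definition scan_state := option (nat * nat * nat * nat).

(** The bound [b] on the number of symbols keeps every counter polynomial. In [i + idx g] the option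
    is coerced to 0 or 1, so [i] points to the next expected entry of [order]. Stream items and
    annotation letters are both read by this step. *)
Definition scan_step (s : scan_state) g : scan_state * seq O :=
  if s is Some (c, i, x, y) then
    if [&& c < b, ok g & if idx g is Some j then onth order i == Some j else true]
    then (Some (c.+1, i + idx g, x + hash R (lft g), y + hash R (rgt g)), out g)
    else (None, [::])
  else (None, [::]).

(** Only a prefix is asked for here; that [order] has been exhausted can be checked only when the
    annotation ends. *)
Definition scan_ok c i gs :=
  [&& c + size gs <= b, all ok gs & prefix (pmap idx gs) (drop i order)].

Lemma run_scan_None gs : (run scan_step None gs).1 = None.
Proof. by elim: gs => //= g gs; case: run. Qed.

Lemma scan_ok_cons c i g gs : scan_ok c i (g :: gs) =
  [&& c < b, ok g & if idx g is Some j then onth order i == Some j else true] &&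
  scan_ok c.+1 (i + idx g) gs.
Proof.
rewrite /scan_ok /= addSnnS -!andbA.
have [le_b|] := leqP (c + (size gs).+1) b; last by rewrite !andbF.
rewrite (_ : c < b) /=; last by lia.
case: (ok g) => //=; case: (idx g) => [j|] /=; last by rewrite addn0.
rewrite [RHS]andbCA; case: (all ok gs) => //=; rewrite addn1.
have [lt_i|le_i] := ltnP i (size order); last first.
  by rewrite onth_default // drop_oversize.
by rewrite (drop_nth j) // prefix_cons onthE (nth_map j) // (inj_eq Some_inj) eq_sym.
Qed.

Lemma run_scan c i x y gs : scan_ok c i gs ->
  run scan_step (Some (c, i, x, y)) gs =
  (Some (c + size gs, i + size (pmap idx gs), x + hash R (flatten (map lft gs)),
         y + hash R (flatten (map rgt gs))), flatten (map out gs)).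
Proof.
elim: gs c i x y => [|g gs IHgs] c i x y.
  by rewrite /= /hash !big_nil !addn0.
rewrite scan_ok_cons => /andP[/= -> /IHgs ->]; rewrite !hash_cat !addnA.
by case: (idx g) => [j|]; congr (Some (_, _, _, _), _) => /=; lia.
Qed.

Lemma run_scan_bad c i x y gs : c <= b -> ~~ scan_ok c i gs ->
  (run scan_step (Some (c, i, x, y)) gs).1 = None.
Proof.
elim: gs c i x y => [|g gs IHgs] c i x y le_b.
  by rewrite /scan_ok /= addn0 le_b prefix0s.
rewrite scan_ok_cons negb_and /=; case: ifP => [/andP[lt_b _] /= bad|_ _].
  by have := IHgs _ _ (x + hash R (lft g)) (y + hash R (rgt g)) lt_b bad; case: run.
by have := run_scan_None gs; case: run.
Qed.

End Scan.

Lemma card_bseq_le (W : finType) p :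
  0 < #|W| -> #|{: p.-bseq W}| <= p.+1 * #|W| ^ p.
Proof.
case/card_gt0P => w0 _.
pose pad (s : p.-bseq W) := (inord (size s) : 'I_p.+1, [tuple nth w0 s i | i < p]).
have pad_inj : injective pad.
  move=> s t /eqP; rewrite xpair_eqE => /andP[/eqP/(congr1 val) /=].
  rewrite !inordK ?ltnS ?size_bseq // => eq_sz /eqP eq_nth.
  apply/val_inj/(@eq_from_nth _ w0) => // i lt_i.
  have lt_p : i < p := leq_trans lt_i (size_bseq s).
  by have := congr1 (fun u => tnth u (Ordinal lt_p)) eq_nth; rewrite !tnth_mktuple.
apply: leq_trans (leq_card _ pad_inj) _.
by rewrite card_prod card_ord card_tuple.
Qed.

Definition small_state (W : Type) (Q p : nat) (x : scan_state * seq W) : Prop :=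
  (if x.1 is Some (c, i, x, y) then [&& c <= Q, i <= Q, x <= Q & y <= Q] else true)
  && (size x.2 <= p).

(** The first factor counts four counters together with the rejected state, the second the possible
    buffers. When they fit into [w] words an injection exists, and the decoder is its inverse, with
    a default off the image. *)
Lemma scan_state_code (W : finType) (Q p w : nat) :
  0 < #|W| -> (Q.+1 ^ 4).+1 * (p.+1 * #|W| ^ p) <= #|W| ^ w ->
  exists enc : scan_state * seq W -> w.-tuple W, exists dec,
    forall x, small_state Q p x -> dec (enc x) = x.
Proof.
move=> W_gt0 le_w.
pose F := (option ('I_Q.+1 * 'I_Q.+1 * 'I_Q.+1 * 'I_Q.+1) * p.-bseq W)%type.
pose code (x : scan_state * seq W) : F :=
  (omap (fun '(c, i, x, y) => (inord c, inord i, inord x, inord y)) x.1,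
   insub_bseq p x.2).
pose decode (u : F) : scan_state * seq W :=
  (if u.1 is Some (c, i, x, y) then
     Some (nat_of_ord c, nat_of_ord i, nat_of_ord x, nat_of_ord y) else None,
   bseqval u.2).
have codeK x : small_state Q p x -> decode (code x) = x.
  case: x => s buf /andP[/= le_Q le_p]; congr (_, _); last by rewrite /= insubdK.
  case: s le_Q => [[[[c i] x] y]|] //= /and4P[lec lei lex ley].
  by rewrite !inordK.
have /inj_finType_exists[g g_inj] : #|{: F}| <= #|{: w.-tuple W}|.
  rewrite card_tuple; apply: leq_trans le_w.
  rewrite card_prod card_option !card_prod !card_ord.
  have -> : Q.+1 * Q.+1 * Q.+1 * Q.+1 = Q.+1 ^ 4 by rewrite !expnS muln1 !mulnA.
  by rewrite leq_mul2l card_bseq_le ?orbT.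
exists (g \o code), (fun u => oapp decode (None, [::]) [pick v | g v == u]) => x sm.
case: pickP => [v /eqP/g_inj -> /=|/(_ (code x))]; first exact: codeK.
by rewrite eqxx.
Qed.

(** * The fingerprint protocol *)

Section FingerprintProtocol.

Variables (m : nat) (I O : Type) (f : problem m I O).
Variables (L Z : finType) (J : eqType).
Variables (ok : pred L) (idx : L -> option J) (order : seq J) (out : L -> seq O).
Variables (base : seq Z) (keys : I -> seq Z) (lft rgt : L -> seq Z).
Variables (p b hmax C h : nat).

(** The deterministic ideal of the test: the verifier replaces the equality of multisets by the
    equality of their hashes. *)
Definition fingerprint_accepts (A : seq I) ls : Prop :=
  [/\ all ok ls, pmap idx ls = order &
      perm_eq (base ++ flatten (map keys A) ++ flatten (map lft ls))
              (flatten (map rgt ls))].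

Hypotheses (p_gt0 : 0 < p) (card_L : #|L| <= (m + 2) ^ p).
Hypotheses (b_le : b <= (m + 2) ^ p) (base_le : size base <= (m + 2) ^ p).
Hypothesis keys_le : forall x, size (keys x) <= (m + 2) ^ p.
Hypothesis lft_le : forall l, size (lft l) <= (m + 2) ^ p.
Hypothesis rgt_le : forall l, size (rgt l) <= (m + 2) ^ p.
Hypothesis sound : forall (A : m.-tuple I) ls,
  fingerprint_accepts A ls -> f A (flatten (map out ls)).
Hypothesis complete : forall (A : m.-tuple I) o, f A o ->
  exists2 ls, fingerprint_accepts A ls & size ls <= hmax.
Hypotheses (hmax_le : m + hmax <= b) (cost_le : p * hmax <= C * (h + 1)).
Hypothesis mem_le : 10 * p + 17 <= C.

Local Notation k := (2 * #|Z|).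

Let item_step (R : {ffun Z -> 'I_4}) :=
  @scan_step I O J Z xpredT (fun=> None) order (fun=> [::]) keys (fun=> [::]) b R.
Let letter_step (R : {ffun Z -> 'I_4}) :=
  @scan_step L O J Z ok idx order out lft rgt b R.

Let good ls := [&& m + size ls <= b, all ok ls & pmap idx ls == order].

Let P := (m + 2) ^ p.

(** Each element adds at most 3 to a hash; [base] has at most [P] elements and so has the
    contribution of each of the [c] symbols read. The buffer is never full between two reads. *)
Let Inv (x : scan_state * seq (word m)) : Prop :=
  (if x.1 is Some (c, i, x, y) then
     [&& c <= b, i <= c, x <= 3 * (P + c * P) & y <= 3 * (c * P)] else true)
  && (size x.2 < p).

Let Inv_step G ok' idx' (out' : G -> seq O) lft' rgt' R s buf g :
  (forall g, size (lft' g) <= P) -> (forall g, size (rgt' g) <= P) ->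
  size buf < p -> Inv (s, buf) ->
  Inv ((@scan_step G O J Z ok' idx' order out' lft' rgt' b R s g).1, buf).
Proof.
move=> lft_P rgt_P lt_p; rewrite /Inv /= lt_p !andbT.
case: s => [[[[c i] x] y]|] //= /and4P[lec lei lex ley].
case: ifP => //= /andP[lt_b _]; have := lft_P g; have := rgt_P g.
have := hash_le R (lft' g); have := hash_le R (rgt' g).
by case: (idx' g) => [j|] /=; rewrite mulSn; lia.
Qed.

(** An annotation that is no spelling, or fails the deterministic checks, is always rejected.
    Otherwise either the multisets agree, and then every random string leads to the same output,
    correct by [sound]; or they differ, and acceptance requires a hash collision. *)
Lemma fingerprint_protocol : exists V : verifier m I O, hv_protocol C V f h 1.
Proof.
(* One word pays for the rejected state, [2 * p + 4] words for each of the four counters, and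
   [2 * p] words for the buffer and its length. *)
pose w := 10 * p + 17; pose B := #|{: word m}|.
have le_B : m + 2 <= B := word_card m.
have B_gt1 : 1 < B by lia.
have P_gt0 : 0 < P by rewrite expn_gt0; lia.
(* At most [b], hence at most [P], symbols are read, so the hashes stay below 3(P + P^2), which is
   at most 8 P^2; the factor 8 is at most (m + 2)^3. *)
pose Q := (m + 2) ^ (2 * p + 3).
have le_Q : 3 * (P + P * P) <= Q.
  rewrite /Q expnD mul2n -addnn expnD -/P.
  have : 2 ^ 3 <= (m + 2) ^ 3 by rewrite leq_exp2r //; lia.
  by move=> le8; apply: leq_trans (leq_mul (leqnn (P * P)) le8); nia.
have small x : Inv x -> small_state Q p x.
  case: x => -[[[[c i] x] y]|] buf /andP[/=] le_inv lt_p; rewrite /small_state /=;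
    rewrite (ltnW lt_p) ?andbT //; move: le_inv => // /and4P[lec lei lex ley].
  have leP : c <= P by apply: leq_trans b_le.
  by apply/and4P; split; nia.
have [enc [dec encK]] : exists enc : scan_state * seq (word m) -> w.-tuple (word m),
    exists dec, forall x, small_state Q p x -> dec (enc x) = x.
  apply: scan_state_code; first by rewrite -/B; lia.
  rewrite -/B; have le_QB : Q.+1 <= B ^ (2 * p + 4).
    rewrite addnS expnS; apply: leq_trans (leq_mul B_gt1 (leqnn _)).
    have : Q <= B ^ (2 * p + 3) by rewrite leq_exp2r // addnS.
    have : 0 < B ^ (2 * p + 3) by rewrite expn_gt0; lia.
    by lia.
  have le_pB : p.+1 <= B ^ p by exact: ltn_expl.
  have -> : w = 1 + 4 * (2 * p + 4) + (p + p) by rewrite /w; lia.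
  rewrite 2!expnD expn1 (expnD B p p).
  apply: leq_mul; last by rewrite leq_mul2r le_pB orbT.
  have le4 : Q.+1 ^ 4 <= B ^ (4 * (2 * p + 4)) by rewrite mulnC expnM leq_exp2r.
  apply: leq_trans (leq_mul B_gt1 le4); have : 0 < Q.+1 ^ 4 by rewrite expn_gt0.
  by lia.
have encK' x : Inv x -> dec (enc x) = x by move/small/encK.
have [spl spl_inj] : exists spl : L -> p.-tuple (word m), injective spl.
  apply: inj_finType_exists; rewrite card_tuple -/B; apply: leq_trans card_L _.
  by rewrite leq_exp2r.
have [rnd rnd_inj] := random_function_of_coins Z.
pose start (r : k.-tuple bool) : scan_state * seq (word m) :=
  (Some (0, 0, hash (rnd r) base, 0), [::]).
pose item (r : k.-tuple bool) (x : scan_state * seq (word m)) (t : I) :=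
  let: (s, o) := item_step (rnd r) x.1 t in ((s, x.2), o).
pose wrd (r : k.-tuple bool) := buffered_step spl (letter_step (rnd r)) None.
pose fin (r : k.-tuple bool) (x : scan_state * seq (word m)) : option (seq O) :=
  if x.1 is Some (c, i, x1, y1) then
    if [&& nilp x.2, i == size order & x1 == y1] then Some [::] else None
  else None.
pose V := coded_verifier enc dec start item wrd fin.
have Iitem r x t : Inv x -> Inv (item r x t).1.
  case: x => s buf Ix; rewrite /item /=.
  have lt_p : size buf < p by case/andP: Ix.
  have := @Inv_step I xpredT (fun=> None) (fun=> [::]) keys (fun=> [::]) (rnd r) s
    buf t keys_le (fun=> leq0n _) lt_p Ix.
  by rewrite -/(item_step _ _ _); case: item_step.
have Iwrd r x t : Inv x -> Inv (wrd r x t).1.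
  case: x => s buf Ix; rewrite /wrd /buffered_step /=.
  case: ifP => [lt_p|_].
    by rewrite /Inv /= lt_p andbT; case/andP: Ix.
  case: pickP => [l _|_]; last by rewrite /Inv /= p_gt0.
  have Ix0 : Inv (s, [::]) by rewrite /Inv /= p_gt0 andbT; case/andP: Ix.
  have := @Inv_step L ok idx out lft rgt (rnd r) s [::] l lft_le rgt_le p_gt0 Ix0.
  by rewrite -/(letter_step _ _ _); case: letter_step.
have Istart r : Inv (start r).
  rewrite /Inv /start /= p_gt0 andbT /=.
  by have := hash_le (rnd r) base; rewrite mul0n; lia.
have outE r A a : @output _ _ _ V r A a =
    let: (t2, o2) := run (wrd r)
      (Some (m, 0, hash (rnd r) (base ++ flatten (map keys A)), 0), [::]) a in
    omap (fun o3 => o2 ++ o3) (fin r t2).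
  rewrite (@output_coded _ _ _ _ _ _ _ _ _ encK' start item wrd fin r A a
    (Iitem r) (Iwrd r) (Istart r)).
  have run_item x (xs : seq I) : run (item r) x xs =
      let: (s, o) := run (item_step (rnd r)) x.1 xs in ((s, x.2), o).
    elim: xs x => [|t xs IHxs] [s buf] //=.
    rewrite /item /=; case: item_step => s1 o1; rewrite IHxs /=.
    by case: run.
  have none : pmap (fun=> None : option J) A = [::] by elim: (tval A).
  have nilO : flatten (map (fun=> [::] : seq O) A) = [::] by elim: (tval A).
  have nilZ : flatten (map (fun=> [::] : seq Z) A) = [::] by elim: (tval A).
  rewrite run_item run_scan.
    by rewrite size_tuple none nilO nilZ hash_cat /= /hash big_nil.
  by rewrite /scan_ok size_tuple all_predT none prefix0s; lia.
have out_bad r A a : (forall ls, a <> spell spl ls) -> @output _ _ _ V r A a = None.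
  move=> not_spell; rewrite outE.
  have := run_not_spell (step := letter_step (rnd r)) p_gt0 (dead := None) (fun=> erefl)
    (Some (m, 0, hash (rnd r) (base ++ flatten (map keys A)), 0)) not_spell.
  rewrite -/(wrd r); case: run => -[s buf] o /= [->|buf_ne] //.
  by rewrite /fin /=; case: s => [[[[? ?] ?] ?]|] //; case: nilP.
have out_spell r (A : m.-tuple I) ls : @output _ _ _ V r A (spell spl ls) =
    if good ls &&
       (hash (rnd r) (base ++ flatten (map keys A) ++ flatten (map lft ls))
        == hash (rnd r) (flatten (map rgt ls)))
    then Some (flatten (map out ls)) else None.
  rewrite outE /wrd run_spell //.
  have [sok|nok] := boolP (scan_ok ok idx order b m 0 ls).
    rewrite /letter_step run_scan //= /fin /= !add0n -hash_cat -catA.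
    case/and3P: sok => szb aok; rewrite drop0 => /prefixP[s2 eq_order].
    (* The final test compares lengths only; a prefix of [order] of full length is [order]. *)
    have -> : (size (pmap idx ls) == size order) = (pmap idx ls == order).
      apply/eqP/eqP => [|-> //]; rewrite eq_order size_cat => eq_sz.
      by rewrite (size0nil (s := s2)) ?cats0 //; lia.
    by rewrite /good szb aok /=; case: eqP => //= _; case: eqP; rewrite //= cats0.
  have := run_scan_bad out lft rgt (rnd r)
    (hash (rnd r) (base ++ flatten (map keys A))) 0 (_ : m <= b) nok.
  rewrite -/(letter_step _); case: run => s o /= ->; last by lia.
  case: ifP => // /andP[/and3P[szb aok /eqP eq_order] _].
  by case/negP: nok; rewrite /scan_ok szb aok drop0 eq_order prefix_refl.
have valid_good (A : m.-tuple I) ls : good ls ->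
    perm_eq (base ++ flatten (map keys A) ++ flatten (map lft ls)) (flatten (map rgt ls)) ->
    valid_for V f (fun=> spell spl ls) A.
  move=> gls eq_lr; apply: prob_eq1 => r; exists (flatten (map out ls)).
    by rewrite out_spell gls (perm_hash _ eq_lr) eqxx.
  by case/and3P: gls => _ aok /eqP ?; apply: sound.
exists V; apply: hv_protocol_of_annotations => [A a|A o fAo|]; last by rewrite /=; lia.
  have [[ls ->]|not_spell] := pselect (exists ls, a = spell spl ls); last first.
    right; apply: (prob_le_third (F := set0)) => [r|]; last by rewrite cards0.
    by rewrite out_bad // => ls eq_a; apply: not_spell; exists ls.
  have [gls|bad] := boolP (good ls); last first.
    right; apply: (prob_le_third (F := set0)) => [r|]; last by rewrite cards0.
    by rewrite out_spell (negPf bad).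
  have [/valid_good|neq] := boolP (perm_eq (base ++ flatten (map keys A) ++
     flatten (map lft ls)) (flatten (map rgt ls))); first by left; auto.
  right; apply: prob_le_third (prob_collision_le_third rnd_inj neq) => r.
  by rewrite out_spell gls inE /=; case: eqP.
have [ls [aok eq_order eq_lr] szls] := complete fAo.
exists (spell spl ls).
  by apply: valid_good => //; rewrite /good aok eq_order eqxx !andbT; lia.
by rewrite size_spell; apply: leq_trans cost_le; rewrite leq_mul2l szls orbT.
Qed.

End FingerprintProtocol.

(** * Facts provided once and looked up many times *)

Lemma count_flatten_map_cat (S T : Type) (f g : S -> seq T) (p : pred T) s :
  count p (flatten [seq f x ++ g x | x <- s]) =
  count p (flatten (map f s) ++ flatten (map g s)).
Proof. by elim: s => //= x s IHs; rewrite !count_cat IHs !count_cat; lia. Qed.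

Lemma pmap_flatten (S T U : Type) (g : T -> option U) (f : S -> seq T) s :
  pmap g (flatten (map f s)) = flatten [seq pmap g (f x) | x <- s].
Proof. by elim: s => //= x s IHs; rewrite pmap_cat IHs. Qed.

Lemma flatten_map_map (S T U : Type) (g : T -> U) (f : S -> seq T) s :
  flatten [seq map g (f x) | x <- s] = map g (flatten (map f s)).
Proof. by elim: s => //= x s ->; rewrite map_cat. Qed.

(** All lookups of a fact are charged to the first letter that provides it; later providers of the
    same fact receive multiplicity 0. *)
Lemma exists_multiplicities (X : eqType) (T : Type) (prov : T -> X) K ls q :
  size q <= K -> {subset q <= map prov ls} ->
  exists2 lks : seq (T * 'I_K.+1), map fst lks = ls &
    perm_eq (flatten [seq nseq lk.2 (prov lk.1) | lk : T * 'I_K.+1 <- lks]) q.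
Proof.
elim: ls q => [|l ls IHls] q le_q sub_q.
  by exists [::] => //; case: q sub_q {le_q} => // x q /(_ x); rewrite inE eqxx => /(_ isT).
have [||lks map_lks eq_lks] := IHls [seq x <- q | x != prov l].
- by apply: leq_trans le_q; rewrite size_filter count_size.
- move=> x; rewrite mem_filter => /andP[neq /sub_q].
  by rewrite inE (negPf neq).
have lt_k : count_mem (prov l) q < K.+1 by rewrite ltnS (leq_trans (count_size _ _)).
exists ((l, Ordinal lt_k) :: lks); first by rewrite /= map_lks.
rewrite /= (_ : nseq _ _ = [seq x <- q | x == prov l]).
  apply: perm_trans (permEl (perm_filterC (pred1 (prov l)) q)).
  by rewrite perm_cat2l.
by elim: (q) => //= x s <-; case: eqP => //= ->.
Qed.

Section LookupProtocol.

Variables (m : nat) (I O : Type) (f : problem m I O).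
Variables (L X Y : finType) (J : eqType).
Variables (ok : pred L) (idx : L -> option J) (order : seq J) (out : L -> seq O).
Variables (prov : L -> X) (cons : L -> seq X).
Variables (base : seq Y) (keys : I -> seq Y) (uses : L -> seq Y).
Variables (a hmax C h : nat).

(* Every letter provides one fact, which others may look up any number of times. *)
Definition lookup_accepts (A : seq I) ls : Prop :=
  [/\ all ok ls, pmap idx ls = order,
      perm_eq (base ++ flatten (map keys A)) (flatten (map uses ls)) &
      {subset flatten (map cons ls) <= map prov ls}].

Hypotheses (card_L : #|L| <= (m + 2) ^ a) (base_le : size base <= (m + 2) ^ a).
Hypothesis keys_le : forall x, size (keys x) <= (m + 2) ^ a.
Hypothesis cons_uses_le : forall l, size (cons l) + size (uses l) <= 8.
Hypothesis sound : forall (A : m.-tuple I) ls,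
  lookup_accepts A ls -> f A (flatten (map out ls)).
Hypothesis complete : forall (A : m.-tuple I) o, f A o ->
  exists2 ls, lookup_accepts A ls & size ls <= hmax.
Hypotheses (hmax_le : m + hmax <= (m + 2) ^ a).
Hypothesis cost_le : (2 * a + 4) * hmax <= C * (h + 1).
Hypothesis mem_le : 20 * a + 57 <= C.

(** Each letter is sent with a multiplicity, and puts that many copies of its fact into the left
    multiset; consumed facts go into the right one. Lookups and stream keys live in different
    summands of [X + Y], so a single fingerprint comparison checks both. *)
Theorem lookup_protocol : exists V : verifier m I O, hv_protocol C V f h 1.
Proof.
(* An honest annotation has at most (m + 2)^a letters with at most 8 lookups each, so [K] bounds
   every multiplicity. As [K] is at most (m + 2)^(a + 3), letters with multiplicities number at most
   (m + 2)^(a + (a + 3) + 1). *)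
pose K := 8 * (m + 2) ^ a; pose p := 2 * a + 4.
pose lft (lk : L * 'I_K.+1) : seq (X + Y) := nseq lk.2 (inl (prov lk.1)).
pose rgt (lk : L * 'I_K.+1) : seq (X + Y) := map inl (cons lk.1) ++ map inr (uses lk.1).
have m_gt1 : 1 < m + 2 by lia.
have le_p q : q <= p -> (m + 2) ^ q <= (m + 2) ^ p 
  by move=> ?; apply: leq_pexp2l => //; lia.
have le_ap q : q <= (m + 2) ^ a -> q <= (m + 2) ^ p.
  by move=> le_q; apply: leq_trans le_q (le_p _ _); rewrite /p; lia.
have le8 : 8 <= (m + 2) ^ 3 by have : 2 ^ 3 <= (m + 2) ^ 3 by rewrite leq_exp2r.
have le_K : K <= (m + 2) ^ (a + 3) by rewrite /K expnD [_ ^ a * _]mulnC leq_mul2r le8 orbT.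
have le_8p : 8 <= (m + 2) ^ p by apply: leq_trans le8 (le_p _ _); rewrite /p; lia.
apply: (@fingerprint_protocol m I O f (L * 'I_K.+1)%type (X + Y)%type J
  (fun lk => ok lk.1) (fun lk => idx lk.1) order (fun lk => out lk.1)
  (map inr base) (fun x => map inr (keys x)) lft rgt p ((m + 2) ^ a) hmax C h) => //;
  last by rewrite /p; lia.
- by rewrite /p; lia.
- rewrite card_prod card_ord (_ : p = a + (a + 3) + 1); last by rewrite /p; lia.
  rewrite -addnA expnD; apply: leq_mul => //; rewrite addn1 expnS.
  have : 0 < (m + 2) ^ (a + 3) by rewrite expn_gt0; lia.
  by move: le_K m_gt1; nia.
- exact: le_ap.
- by rewrite size_map; apply: le_ap.
- by move=> x; rewrite size_map; apply: le_ap.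
- move=> lk; rewrite size_nseq -ltnS; apply: leq_trans (ltn_ord _) _.
  rewrite ltnS; apply: leq_trans le_K (le_p _ _); rewrite /p; lia.
- by move=> lk; rewrite size_cat !size_map; apply: leq_trans le_8p.
- move=> A lks [okl ord_l perm_lr].
  have -> : [seq out lk.1 | lk <- lks] = map out (map fst lks) by rewrite -map_comp.
  (* The right summand of the multiset equality gives the comparison with the stream; in the left
     one, membership shows that each consumed fact has a provider. *)
  pose getl (z : X + Y) := if z is inl x then Some x else None.
  pose getr (z : X + Y) := if z is inr y then Some y else None.
  have inlK s : pmap getl (map inl s) = s by elim: s => //= x s ->.
  have inrK s : pmap getr (map inr s) = s by elim: s => //= x s ->.
  have inlN s : pmap getl (map inr s) = [::] by elim: s.
  have inrN s : pmap getr (map inl s) = [::] by elim: s.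
  apply: sound; split; rewrite ?all_map //; first by rewrite -ord_l; elim: (lks) => //= lk s ->.
    have := perm_pmap getr perm_lr; rewrite !pmap_cat !pmap_flatten inrK.
    rewrite (eq_map (g := keys)) => [|x]; last exact: inrK.
    rewrite [flatten [seq _ | lk <- lks]](_ : _ = [::]); last first.
      by elim: (lks) => //= lk s ->; rewrite /lft; elim: (nat_of_ord lk.2).
    rewrite cats0 => /perm_trans; apply; rewrite -map_comp.
    by rewrite (eq_map (g := uses \o fst)) // => lk; rewrite pmap_cat inrN inrK.
  move=> x x_cons.
  have : x \in pmap getl (flatten (map rgt lks)).
    have -> : pmap getl (flatten (map rgt lks)) = flatten (map cons (map fst lks)).
      rewrite pmap_flatten -map_comp; congr flatten; apply: eq_map => lk /=.
      by rewrite pmap_cat inlK inlN cats0.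
    exact: x_cons.
  rewrite -(perm_mem (perm_pmap getl perm_lr)) !pmap_cat !pmap_flatten inlN.
  rewrite (eq_map (g := fun=> [::])) => [|y]; last exact: inlN.
  rewrite [flatten (map _ A)](_ : _ = [::]) /=; last by elim: (tval A).
  case/flatten_mapP => lk lk_in.
  have -> : pmap getl (lft lk) = nseq lk.2 (prov lk.1).
    by rewrite /lft; elim: (nat_of_ord lk.2) => //= n ->.
  by rewrite mem_nseq => /andP[_ /eqP ->]; rewrite -map_comp; apply/mapP; exists lk.
move=> A o fAo; have [ls [okl ord_l perm_l sub_l] le_ls] := complete fAo.
have szq : size (flatten (map cons ls)) <= K.
  apply: leq_trans (_ : 8 * hmax <= K); last by rewrite leq_mul2l /=; lia.
  apply: leq_trans (_ : 8 * size ls <= _); last by rewrite leq_mul2l.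
  elim: (ls) => //= l s IHs; rewrite size_cat mulnS; apply: leq_add IHs.
  exact: leq_trans (leq_addr _ _) (cons_uses_le l).
have [lks map_lks eq_lks] := exists_multiplicities szq sub_l.
exists lks; last by rewrite -(size_map fst) map_lks.
split; first by rewrite -[all _ _](all_map fst ok) map_lks.
  by rewrite -ord_l -map_lks; elim: (lks) => //= lk s ->.
rewrite flatten_map_map catA -map_cat.
have -> : flatten (map lft lks) =
    map inl (flatten [seq nseq lk.2 (prov lk.1) | lk : L * 'I_K.+1 <- lks]).
  by rewrite -flatten_map_map; congr flatten; apply: eq_map => lk; rewrite map_nseq.
apply/permP => P; rewrite count_flatten_map_cat count_cat.
rewrite !(flatten_map_map _ (fun lk => _ lk.1)) count_cat !count_map addnC.
congr (_ + _).
  by rewrite (permP eq_lks) -map_lks -map_comp.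
by rewrite (permP perm_l) -map_lks -map_comp.
Qed.

End LookupProtocol.

(** * Shortest paths *)

Section CardBounds.

Variables (m : nat).

Lemma card_prod_pow (S T : finType) a b :
  #|S| <= (m + 2) ^ a -> #|T| <= (m + 2) ^ b -> #|{: S * T}| <= (m + 2) ^ (a + b).
Proof. by move=> leS leT; rewrite card_prod expnD leq_mul. Qed.

Lemma card_option_pow (T : finType) a :
  #|T| <= (m + 2) ^ a -> #|{: option T}| <= (m + 2) ^ a.+1.
Proof.
move=> leT; rewrite card_option expnS.
have : 0 < (m + 2) ^ a by rewrite expn_gt0; lia.
by nia.
Qed.

Lemma card_sum_pow (S T : finType) a :
  #|S| <= (m + 2) ^ a -> #|T| <= (m + 2) ^ a -> #|{: S + T}| <= (m + 2) ^ a.+1.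
Proof. by move=> leS leT; rewrite card_sum expnS; nia. Qed.

Lemma card_ord_pow n a : n <= (m + 2) ^ a -> #|'I_n| <= (m + 2) ^ a.
Proof. by rewrite card_ord. Qed.

Lemma card_weaken (T : finType) a b :
  #|T| <= (m + 2) ^ a -> a <= b -> #|T| <= (m + 2) ^ b.
Proof. by move=> leT le_ab; apply: leq_trans leT (leq_pexp2l _ _) => //; lia. Qed.

End CardBounds.

(** This makes a claimed table a function: an index listed once in the prescribed order belongs to a
    single letter. *)
Lemma pmap_uniq_inj (L J : eqType) (idx : L -> option J) ls l1 l2 j :
  uniq (pmap idx ls) -> l1 \in ls -> l2 \in ls ->
  idx l1 = Some j -> idx l2 = Some j -> l1 = l2.
Proof.
have notin l s : idx l = Some j -> j \notin pmap idx s -> l \notin s.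
  move=> idx_l; apply: contraNN => l_in.
  by rewrite mem_pmap -idx_l; apply: map_f.
elim: ls => //= l ls IHls uniq_ls; rewrite !inE.
move=> /predU1P[->|in1] /predU1P[->|in2] // idx1 idx2.
- by move: uniq_ls; rewrite idx1 /= => /andP[/(notin _ _ idx2)]; rewrite in2.
- by move: uniq_ls; rewrite idx2 /= => /andP[/(notin _ _ idx1)]; rewrite in1.
by apply: IHls => //; move: uniq_ls; case: (idx l) => //= j' /andP[].
Qed.

(** * Distances in a weighted graph *)

Section Distances.

Variables (n W : nat) (directed : bool) (E : seq (edge n W)) (s : 'I_n).

Local Notation dist := (distance directed E s).

Lemma distance_inj v d1 d2 : dist v d1 -> dist v d2 -> d1 = d2.
Proof.
by move=> [p1 min1] [p2 min2]; apply/eqP; rewrite eqn_leq min1 // min2.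
Qed.

(** Removing the last edge of a shortest path leaves a shortest path, since a shorter one could be
    extended by that edge. *)
Lemma distance_pred v d : dist v d ->
  (v = s /\ d = 0) \/
  exists x e d', [/\ dist x d', e \in E, traverses directed e x v & d = d' + weight e].
Proof.
move=> [pv]; case: pv => [|x {}v e d' px eE tr] min_d; first by left.
right; exists x, e, d'; split=> //; split=> // d2 p2.
by have := min_d _ (path_step p2 eE tr); lia.
Qed.

Lemma weight_le (e : edge n W) : weight e <= W.
Proof. exact: ltn_ord. Qed.

(* Along a shortest path the distances grow by at most W at each step, and each
   step leaves one more node at a smaller distance behind. *)
Lemma distance_le v d : dist v d -> d <= n * W.
Proof.
pose below k := [set x | `[< exists2 d', dist x d' & d' < k >]].
suff le_below k u : dist u k -> k <= #|below k| * W.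
  move=> /le_below/leq_trans; apply; rewrite leq_mul2r -[X in _ <= X]card_ord.
  by rewrite max_card orbT.
have [b] := ubnP k; elim: b k u => // b IHb k u lt_b.
case/distance_pred=> [[_ ->] //|[x [e [d' [dx eE _ eq_k]]]]].
have lt_k : d' < k by rewrite eq_k addnS ltnS leq_addr.
have le_d' := IHb d' x (leq_trans lt_k lt_b) dx.
have : #|below d'| < #|below k|.
  apply: proper_card; apply/properP; split.
    apply/subsetP => y; rewrite !inE => /asboolP[d2 dy lt_d2]; apply/asboolP.
    by exists d2 => //; lia.
  exists x; rewrite inE; first by apply/asboolP; exists d'.
  by apply/asboolP => -[d2 /(distance_inj dx) <-]; rewrite ltnn.
by have := weight_le e; nia.
Qed.

End Distances.

(** * Certificates for shortest paths *)

Section ShortestPaths.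

Variables (n W : nat) (directed : bool) (m : nat) (ss : seq 'I_n).

(** The list [ss] of sources covers both problems: it has one entry for single-source paths and all
    nodes for all pairs. *)
Definition sp_problem : problem m (edge n W) (sp_entry n) :=
  fun A o => exists2 t : 'I_n -> 'I_n -> sp_entry n,
    o = [seq t s v | s <- ss, v <- enum 'I_n] &
    forall s v, s \in ss -> correct_entry directed A s v (t s v).

Local Notation dval := 'I_(n * W).+1.

(* For v reached from s: its distance and, unless v = s, its predecessor x, the
   edge from x to v, and the distance of x. *)
Definition sp_claim : finType := option (dval * option ('I_n * edge n W * dval)).
Definition sp_letter : finType :=
  ('I_n * 'I_n * sp_claim + 'I_n * edge n W * option dval * option dval)%type.

(** [None] plays the role of the infinite distance. *)
Definition relaxed (du dv : option dval) (w : nat) : bool :=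
  if du is Some a then if dv is Some b then b <= a + w else false else true.

Definition sp_ok (l : sp_letter) : bool :=
  match l with
  | inl (s, v, None) => v != s
  | inl (s, v, Some (d, None)) => (v == s) && (d == 0 :> nat)
  | inl (s, v, Some (d, Some (x, e, d'))) =>
      [&& v != s, traverses directed e x v & d == d' + weight e :> nat]
  | inr (_, e, du, dv) =>
      relaxed du dv (weight e) && (directed || relaxed dv du (weight e))
  end.

Definition sp_idx (l : sp_letter) : option ('I_n * 'I_n) :=
  if l is inl (sv, _) then Some sv else None.

Definition claim_entry (t : sp_claim) : sp_entry n :=
  if t is Some (d, q) then
    Some (nat_of_ord d, omap (fun q : 'I_n * edge n W * dval => q.1.1) q)
  else None.

Definition sp_out (l : sp_letter) : seq (sp_entry n) :=
  if l is inl (_, t) then [:: claim_entry t] else [::].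

Definition sp_fact : finType := ('I_n * 'I_n * option dval + edge n W)%type.

Definition sp_prov (l : sp_letter) : sp_fact :=
  match l with
  | inl (sv, t) => inl (sv, omap fst t)
  | inr (_, e, _, _) => inr e
  end.

Definition sp_cons (l : sp_letter) : seq sp_fact :=
  match l with
  | inl (s, _, Some (_, Some (x, e, d'))) => [:: inl (s, x, Some d'); inr e]
  | inl _ => [::]
  | inr (s, e, du, dv) => [:: inl (s, source e, du); inl (s, target e, dv)]
  end.

Definition sp_uses (l : sp_letter) : seq ('I_n * edge n W) :=
  if l is inr (s, e, _, _) then [:: (s, e)] else [::].

(** An edge has to be tested against the distances from each source, so every occurrence in the
    stream calls for one edge letter per source. *)
Definition sp_keys (e : edge n W) : seq ('I_n * edge n W) := [seq (s, e) | s <- ss].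

Definition sp_order : seq ('I_n * 'I_n) := [seq (s, v) | s <- ss, v <- enum 'I_n].

Local Notation accepts := (lookup_accepts sp_ok sp_idx sp_order sp_prov sp_cons [::]
  sp_keys sp_uses).

(** Relaxed edges keep each claimed distance at most the length of any path, so a node claimed
    unreachable has none; claimed predecessors trace a path of exactly the claimed length. Hence the
    claims are the distances. *)
Lemma sp_sound (A : m.-tuple (edge n W)) ls :
  uniq ss -> accepts A ls -> sp_problem A (flatten (map sp_out ls)).
Proof.
move=> ss_uniq [/allP ok_ls ord_ls perm_ls sub_ls].
have ord_uniq : uniq (pmap sp_idx ls).
  by rewrite ord_ls allpairs_uniq ?enum_uniq // => -[? ?] [? ?].
pose tab sv : sp_claim := odflt None [pick t | inl (sv, t) \in ls].
have tabE sv t : inl (sv, t) \in ls -> tab sv = t.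
  rewrite /tab; case: pickP => [t' in' in_t|/(_ t) -> //].
  by have [] := @pmap_uniq_inj _ _ sp_idx ls _ _ sv ord_uniq in' in_t erefl erefl.
have tab_in s v : s \in ss -> inl (s, v, tab (s, v)) \in ls.
  move=> s_in; have : Some (s, v) \in map sp_idx ls.
    by rewrite -mem_pmap ord_ls; apply/allpairsP; exists (s, v); rewrite mem_enum.
  by case/mapP => -[[sv t]|[[[? ?] ?] ?]] //= in_ls [->]; rewrite (tabE _ t).
exists (fun s v => claim_entry (tab (s, v))).
  transitivity [seq claim_entry (tab sv) | sv <- pmap sp_idx ls]; last first.
    by rewrite ord_ls /sp_order map_allpairs.
  have : {subset ls <= ls} by [].
  elim: {1 3 4}ls => //= l r IHr sub_r.
  have -> := IHr (fun x x_in => sub_r x (mem_behead (s := l :: r) x_in)).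
  have l_in := sub_r l (mem_head l r); move: l_in.
  by case: l {sub_r} => [[sv t]|[[[? ?] ?] ?]] //= /tabE ->.
have lookup s v d : inl (s, v, d) \in map sp_prov ls -> d = omap fst (tab (s, v)).
  by case/mapP => -[[sv t]|[[[? ?] ?] ?]] //= in_ls [-> ->]; rewrite (tabE _ t).
have looked l x : l \in ls -> x \in sp_cons l -> x \in map sp_prov ls.
  by move=> l_in x_in; apply: sub_ls; apply/flatten_mapP; exists l.
have uses_mem s e : (s, e) \in flatten (map sp_uses ls) = (s \in ss) && (e \in A).
  rewrite -(perm_mem perm_ls) /=; apply/flatten_mapP/andP.
    by case=> e' e'_in /mapP[s' s'_in [-> ->]].
  by case=> s_in e_in; exists e => //; apply: map_f.
have edge_mem e : inr e \in map sp_prov ls -> e \in A.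
  case/mapP => -[[sv t]|[[[s e'] du] dv]] //= in_ls [->].
  suff: (s, e') \in flatten (map sp_uses ls) by rewrite uses_mem => /andP[].
  by apply/flatten_mapP; exists (inr (s, e', du, dv)); rewrite //= mem_head.
move=> s v s_in; pose dd x := omap fst (tab (s, x)).
have relax_edge e : e \in A -> relaxed (dd (source e)) (dd (target e)) (weight e) &&
    (directed || relaxed (dd (target e)) (dd (source e)) (weight e)).
  move=> e_in; have : (s, e) \in flatten (map sp_uses ls) by rewrite uses_mem s_in.
  case/flatten_mapP => -[[sv t]|[[[s' e'] du] dv]] //= in_ls.
  rewrite inE => /eqP[es ee]; subst s' e'; rewrite /dd.
  have /lookup <- := looked _ _ in_ls (mem_head _ _).
  have /lookup <- : inl (s, target e, dv) \in map sp_prov ls.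
    by apply: looked in_ls _; rewrite /= !inE eqxx orbT.
  exact: ok_ls in_ls.
have relax_step e x u : e \in A -> traverses directed e x u ->
    relaxed (dd x) (dd u) (weight e).
  move=> /relax_edge/andP[fwd bwd] /orP[/andP[/eqP <- /eqP <-] //|].
  by rewrite -andbA => /and3P[/negPf undir /eqP <- /eqP <-]; rewrite undir in bwd.
have ok_tab u : sp_ok (inl (s, u, tab (s, u))) by apply/ok_ls/tab_in.
have dd_path u d : path_length directed A s u d -> exists2 b, dd u = Some b & b <= d.
  elim=> [|x u' e d' _ [b dx le_b] e_in tr].
    rewrite /dd; have := ok_tab s; case: (tab (s, s)) => [[d0 [[[x e] d']|]]|] //=;
      rewrite eqxx //= => /eqP d0_eq.
    by exists d0; rewrite ?d0_eq.
  have := relax_step e x u' e_in tr; rewrite dx /=; case: (dd u') => // b' le_b'.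
  by exists b' => //; lia.
(* Lookups could be circular a priori. Weights are positive, so the distance looked up for the
   predecessor is strictly smaller, and this grounds the induction. *)
have path_dd k u (b : dval) : b < k -> dd u = Some b -> path_length directed A s u b.
  elim: k u b => // k IHk u b lt_b; rewrite /dd.
  have := ok_tab u; have := looked _ _ (tab_in s u s_in).
  case: (tab (s, u)) => [[d0 [[[x e] d']|]]|] //=.
    move=> look /and3P[_ tr /eqP d0_eq] [eq_b].
    have /lookup/esym dx := look _ (mem_head _ _).
    have /edge_mem e_in : inr e \in map sp_prov ls by apply: look; rewrite !inE eqxx orbT.
    rewrite -eq_b d0_eq; apply: path_step e_in tr; apply: IHk dx.
    by move: lt_b; rewrite -eq_b d0_eq addnS ltnS; apply: leq_trans; rewrite leq_addr.
  by move=> _ /andP[/eqP -> /eqP d0_eq] [<-]; rewrite d0_eq; apply: path_nil.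
have dd_dist u (b : dval) : dd u = Some b -> distance directed A s u b.
  move=> dd_u; split=> [|d' /dd_path[b']]; first exact: path_dd dd_u.
  by rewrite dd_u => -[<-].
have := ok_tab v; have := looked _ _ (tab_in s v s_in); have := dd_dist v.
have := dd_path v; rewrite /dd.
case: (tab (s, v)) => [[d0 [[[x e] d']|]]|] /= dd_v dist_v look.
- case/and3P=> _ tr /eqP d0_eq; split; first exact: dist_v.
  have /lookup/esym dx := look _ (mem_head _ _).
  exists e, d'; split=> //; first exact: path_dd dx.
  by apply: edge_mem; apply: look; rewrite !inE eqxx orbT.
- by case/andP=> /eqP v_s _; split=> //; apply: dist_v.
by move=> _ d /dd_v[].
Qed.

(** The honest annotation consists of the correct table followed by each edge with the true
    distances of its ends, once for every source. *)
Lemma sp_complete (A : m.-tuple (edge n W)) o : sp_problem A o ->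
  exists2 ls, accepts A ls & size ls <= size ss * (n + m).
Proof.
case=> t _ correct.
(* The distances are read off the given correct answer; [inord] is faithful on them by
   [distance_le]. *)
pose dd s x : option dval := omap (fun d => inord d.1) (t s x).
have inordK_dist s x d : distance directed A s x d -> (inord d : dval) = d :> nat.
  by move=> dx; rewrite inordK // ltnS; apply: distance_le dx.
have dd_some s x a : s \in ss -> dd s x = Some a ->
    exists2 d, distance directed A s x d & a = d :> nat.
  move=> /(correct s x); rewrite /dd.
  case: (t s x) => [[d [y|]]|] //= [] => [dx _|_ dx] [<-];
    by exists d => //; apply: inordK_dist dx.
have dd_path s x d : s \in ss -> path_length directed A s x d ->
    exists2 a, dd s x = Some a & a <= d.
  move=> /(correct s x) + px; rewrite /dd.
  case: (t s x) => [[d' [y|]]|] //= => [[dx _]|[_ dx]|/(_ d)//];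
    by exists (inord d') => //; rewrite (inordK_dist _ _ _ dx); apply: dx.2.
have dd_dist s x d : s \in ss -> distance directed A s x d -> dd s x = Some (inord d).
  move=> s_in dx; have [a dd_a _] := dd_path s x d s_in dx.1.
  have [d' dx' eq_a] := dd_some s x a s_in dd_a.
  by rewrite dd_a (distance_inj dx dx') -eq_a inord_val.
have relax_step s e x u : s \in ss -> e \in A -> traverses directed e x u ->
    relaxed (dd s x) (dd s u) (weight e).
  move=> s_in eA tr; case dd_x: (dd s x) => [a|] //=.
  have [d dx eq_a] := dd_some s x a s_in dd_x.
  by have [b -> le_b] := dd_path s u _ s_in (path_step dx.1 eA tr); rewrite eq_a.
have /choice[cl clP] : forall sv, exists c : sp_claim, sv.1 \in ss ->
    [/\ sp_ok (inl (sv, c)), claim_entry c = t sv.1 sv.2, omap fst c = dd sv.1 sv.2 &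
      forall z, z \in sp_cons (inl (sv, c)) ->
        (exists x, z = inl (sv.1, x, dd sv.1 x)) \/ (exists2 e, e \in A & z = inr e)].
  case=> s v; have [s_in|_] := boolP (s \in ss); last by exists None.
  have := correct s v s_in; rewrite /dd /=; case: (t s v) => [[d [x|]]|] /=.
  - case=> dv [e [d' [px eA tr eq_d]]].
    have dx : distance directed A s x d'.
      by split=> // d2 p2; have := dv.2 _ (path_step p2 eA tr); lia.
    exists (Some (inord d, Some (x, e, inord d'))) => _; split=> //=.
    + rewrite tr (inordK_dist _ _ _ dv) (inordK_dist _ _ _ dx) eq_d eqxx !andbT.
      (* The source has distance 0, whereas a node reached by a last edge has positive distance. *)
      apply/eqP => v_s; move: dv; rewrite v_s => -[_ /(_ _ (path_nil _ _ _))].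
      by rewrite eq_d addnS.
    + by rewrite (inordK_dist _ _ _ dv).
    move=> z; rewrite !inE => /orP[/eqP ->|/eqP ->]; last by right; exists e.
    by left; exists x; rewrite -/(dd s x) (dd_dist _ _ _ s_in dx).
  - case=> -> ds; exists (Some (inord d, None)) => _; split=> //=.
      by rewrite eqxx (inordK_dist _ _ _ ds) -leqn0; apply: ds.2; apply: path_nil.
    by rewrite (inordK_dist _ _ _ ds).
  move=> no_path; exists None => _; split=> //=.
  by apply/eqP => v_s; apply: (no_path 0); rewrite v_s; apply: path_nil.
pose tables : seq sp_letter := [seq inl (sv, cl sv) | sv <- sp_order].
pose edges : seq sp_letter :=
  [seq inr (s, e, dd s (source e), dd s (target e)) | e <- A, s <- ss].
have order_ss sv : sv \in sp_order -> sv.1 \in ss.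
  by case/allpairsP => -[s v] [? _ ->].
have prov_table s x : s \in ss -> inl (s, x, dd s x) \in map sp_prov (tables ++ edges).
  move=> s_in; have sx_in : (s, x) \in sp_order.
    by apply/allpairsP; exists (s, x); rewrite mem_enum.
  apply/mapP; exists (inl (s, x, cl (s, x))); last by have [] := clP (s, x) s_in => //= _ _ ->.
  by rewrite mem_cat map_f.
have prov_edge s e : s \in ss -> e \in A -> inr e \in map sp_prov (tables ++ edges).
  move=> s_in eA; apply/mapP.
  exists (inr (s, e, dd s (source e), dd s (target e))) => //.
  by rewrite mem_cat; apply/orP; right; apply/allpairsP; exists (e, s).
exists (tables ++ edges); last first.
  by rewrite size_cat size_map !size_allpairs size_tuple size_enum_ord; lia.
split.
- rewrite all_cat; apply/andP; split; apply/allP => l.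
    by case/mapP => sv /order_ss/clP[? _ _ _] ->.
  case/allpairsP => -[e s] /= [eA s_in ->] /=.
  rewrite relax_step // ?/traverses ?eqxx //=.
  by case: directed relax_step => //= ->; rewrite ?/traverses ?eqxx ?orbT.
- rewrite pmap_cat.
  have -> : pmap sp_idx tables = sp_order by rewrite /tables; elim: (sp_order) => //= sv r ->.
  suff -> : pmap sp_idx edges = [::] by rewrite cats0.
  by rewrite /edges; elim: (tval A) => //= e r IHr; rewrite pmap_cat IHr cats0; elim: (ss).
- rewrite map_cat flatten_cat.
  have -> : flatten (map sp_uses tables) = [::] by rewrite /tables; elim: (sp_order).
  rewrite /edges /=; elim: (tval A) => //= e r IHr.
  rewrite map_cat flatten_cat; apply: perm_cat IHr.
  by rewrite -map_comp /sp_keys; elim: (ss) => //= s' r' IH; rewrite perm_cons.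
move=> z /flatten_mapP[l]; rewrite mem_cat => /orP[|].
  case/mapP => sv sv_in ->; have [_ _ _ consP] := clP _ (order_ss _ sv_in).
  by case/consP => [[x ->]|[e eA ->]]; [apply: prov_table|apply: (prov_edge sv.1)] => //;
    apply: order_ss.
by case/allpairsP => -[e s] /= [eA s_in ->]; rewrite !inE => /orP[] /eqP ->; apply: prov_table.
Qed.

End ShortestPaths.

Lemma sp_protocol (c n m : nat) (directed : bool) (ss : seq 'I_n) C h :
  n <= poly_bound c m -> uniq ss ->
  2 * size ss * (n + m) <= 4 * (h + 1) -> 20 * (10 * c + 5) + 57 <= C ->
  exists V : verifier m (edge n (poly_bound c m)) (sp_entry n),
    hv_protocol C V (sp_problem directed (m := m) ss) h 1.
Proof.
(* Distances take exponent 2c + 1 and edges 3c, so table letters take 10c + 4, which also covers the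
   edge letters; the sum of the two kinds costs one more. *)
set W := poly_bound c m; set a := 10 * c + 5 => le_n ss_uniq le_h le_C.
have le_ss : size ss <= n by rewrite -(card_uniqP ss_uniq) -[X in _ <= X]card_ord max_card.
have W_gt0 : 0 < W by rewrite expn_gt0; lia.
have le_pow k : k <= a -> (m + 2) ^ k <= (m + 2) ^ a by move=> ?; apply: leq_pexp2l => //; lia.
have card_n : #|'I_n| <= (m + 2) ^ c by apply: card_ord_pow.
have card_W : #|'I_W| <= (m + 2) ^ c by apply: card_ord_pow.
have card_d : #|'I_(n * W).+1| <= (m + 2) ^ (c + c).+1.
  by apply: card_ord_pow; rewrite expnS expnD -/(poly_bound c m) -/W; nia.
have card_e := card_prod_pow (card_prod_pow card_n card_n) card_W.
have card_table := card_prod_pow (card_prod_pow card_n card_n) (card_option_pow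
  (card_prod_pow card_d (card_option_pow (card_prod_pow (card_prod_pow card_n card_e) card_d)))).
have card_edges := card_prod_pow (card_prod_pow (card_prod_pow card_n card_e)
  (card_option_pow card_d)) (card_option_pow card_d).
have le_W2 : W * W * (m + 2) <= (m + 2) ^ (c + c).+1.
  by rewrite expnSr expnD -/(poly_bound c m) -/W.
have size_le : size ss * (n + m) + m <= (m + 2) ^ a.
  apply: leq_trans (le_pow (c + c).+2 _); last by rewrite /a; lia.
  rewrite expnSr; apply: leq_trans (leq_mul le_W2 (leqnn _)).
  have : size ss * (n + m) <= W * (W + m) by apply: leq_mul; lia.
  have : W * (W + m) <= W * W * (m + 1) by nia.
  by nia.
apply: (@lookup_protocol m _ _ (sp_problem directed (m := m) ss) (sp_letter n W)
  (sp_fact n W) ('I_n * edge n W)%type _ (@sp_ok n W directed) (@sp_idx n W)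
  (sp_order ss) (@sp_out n W) (@sp_prov n W) (@sp_cons n W) [::] (sp_keys (W := W) ss)
  (@sp_uses n W) a (size ss * (n + m)) C h) => //.
- apply: card_weaken (card_sum_pow (card_weaken card_table _) (card_weaken card_edges _)) _;
    last first.
  + by apply: (_ : (10 * c + 4).+1 <= _); rewrite /a; lia.
  + by lia.
  by lia.
- move=> e; rewrite size_map; apply: leq_trans size_le; nia.
- by case=> [[[s v] [[d [[[x e] d']|]]|]]|[[[s e] du] dv]].
- by move=> A ls; apply: sp_sound.
- by move=> A o; apply: sp_complete.
- by rewrite addnC.
by move: le_h le_C; nia.
Qed.

Lemma sssp_problemE n W directed m (s : 'I_n) :
  @sssp_problem n W directed m s = sp_problem directed (m := m) [:: s].
Proof.
apply/funext => A; apply/funext => o; apply/propext; split=> -[t ->] correct.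
  by exists (fun=> t) => [|s' v]; rewrite /= ?cats0 // inE => /eqP ->.
by exists (t s) => [|v]; rewrite /= ?cats0 //; apply: correct; rewrite inE.
Qed.

Lemma apsp_problemE n W directed m :
  @apsp_problem n W directed m = sp_problem directed (m := m) (enum 'I_n).
Proof.
apply/funext => A; apply/funext => o; apply/propext; split=> -[t ->] correct.
  by exists t.
by exists t => // s v; apply: correct; rewrite mem_enum.
Qed.

(** * Minimum spanning trees *)

Section Forests.

Variables n W : nat.
Implicit Types (e : edge n W) (E F T : seq (edge n W)).

Local Notation joined E u v := (connect (adjacent E) u v).

Lemma adjacentP E u v :
  reflect (exists2 e, e \in E & traverses false e u v) (adjacent E u v).
Proof. exact: hasP. Qed.

Lemma traverses_undirectedC e u v : traverses false e u v = traverses false e v u.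
Proof. by rewrite /traverses /= orbC; congr (_ || _); rewrite andbC. Qed.

Lemma adjacent_sym E : symmetric (adjacent E).
Proof. by move=> u v; apply: eq_has => e; apply: traverses_undirectedC. Qed.

Lemma joined_sym E : connect_sym (adjacent E).
Proof. exact/sym_connect_sym/adjacent_sym. Qed.

Lemma joined_edge E e u v : e \in E -> traverses false e u v -> joined E u v.
Proof. by move=> eE tr; apply/connect1/adjacentP; exists e. Qed.

Lemma joined_ends E e : e \in E -> joined E (source e) (target e).
Proof. by move=> eE; apply: (joined_edge eE); rewrite /traverses !eqxx. Qed.

Lemma joined_trans_edges E F u v :
  (forall e, e \in E -> joined F (source e) (target e)) -> joined E u v -> joined F u v.
Proof.
move=> EF; apply: connect_sub => x y /adjacentP[e eE].
case/orP=> /andP[/eqP <- /eqP <-]; first exact: EF.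
by rewrite joined_sym; apply: EF.
Qed.

Lemma joined_subset E F u v : {subset E <= F} -> joined E u v -> joined F u v.
Proof. by move=> sEF; apply: joined_trans_edges => e /sEF/joined_ends. Qed.

Definition agreeing e := [set f : {ffun 'I_n -> bool} | f (source e) == f (target e)].

(** A vector space over the field with two elements whose dimension is the number of connected
    components; [flip] is its addition. Counting colourings stands in for counting components. *)
Definition colourings E :=
  [set f : {ffun 'I_n -> bool} | all (fun e => f (source e) == f (target e)) E].

Lemma colouring_joined E f u v : f \in colourings E -> joined E u v -> f u = f v.
Proof.
rewrite inE => /allP fE /connectP[p]; elim: p u => [|x p IHp] u /= => [_ ->//|].
case/andP => /adjacentP[e eE tr] /IHp/[apply] <-.
by have /eqP := fE e eE; case/orP: tr => /andP[/eqP <- /eqP <-].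
Qed.

Lemma colourings_cons e E :
  colourings (e :: E) = colourings E :&: agreeing e.
Proof. by apply/setP => f; rewrite !inE andbC. Qed.

Definition flip (g f : {ffun 'I_n -> bool}) : {ffun 'I_n -> bool} :=
  [ffun x => f x (+) g x].

Lemma flip_inj g : injective (flip g).
Proof. by move=> f1 f2 /ffunP eq_f; apply/ffunP => x; have := eq_f x; rewrite !ffunE => /addIb. Qed.

Lemma flip_colouring E g f :
  g \in colourings E -> f \in colourings E -> flip g f \in colourings E.
Proof.
rewrite !inE => /allP gE /allP fE; apply/allP => e eE.
by rewrite !ffunE (eqP (gE e eE)) (eqP (fE e eE)).
Qed.

(** Flipping by one colouring that disagrees across [e] maps the disagreeing colourings injectively
    into the agreeing ones. *)
Lemma colourings_cons_ge e E : #|colourings E| <= 2 * #|colourings (e :: E)|.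
Proof.
rewrite colourings_cons -(cardsID (agreeing e) (colourings E)).
rewrite mul2n -addnn leq_add2l.
have [->|[g]] := set_0Vmem (colourings E :\: (agreeing e)).
  by rewrite cards0.
case/setDP => gE g_e; rewrite -(card_imset _ (@flip_inj g)).
apply/subset_leq_card/subsetP => _ /imsetP[f /setDP[fE f_e] ->]; apply/setIP.
split; first exact: flip_colouring.
by move: g_e f_e; rewrite !inE !ffunE; do 4!case: (fun_of_fin _ _).
Qed.

(** The indicator of the component of [source e] is a colouring that disagrees across [e]; flipping
    by it maps agreeing colourings to disagreeing ones. *)
Lemma colourings_cons_le e E : ~~ joined E (source e) (target e) ->
  2 * #|colourings (e :: E)| <= #|colourings E|.
Proof.
move=> sep; pose g := [ffun x => joined E (source e) x].
have gE : g \in colourings E.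
  rewrite inE; apply/allP => e' e'E; rewrite !ffunE.
  by apply/eqP/same_connect_r/joined_ends => //; apply: joined_sym.
rewrite -(cardsID (agreeing e) (colourings E)).
rewrite colourings_cons mul2n -addnn leq_add2l -(card_imset _ (@flip_inj g)).
apply/subset_leq_card/subsetP => _ /imsetP[f /setIP[fE f_e] ->]; apply/setDP.
split; first exact: flip_colouring.
by move: f_e; rewrite !inE !ffunE connect0 (negPf sep) => /eqP ->; case: (f _).
Qed.

Lemma card_colourings_nil : #|colourings [::]| = 2 ^ n.
Proof.
have -> : colourings [::] = setT by apply/setP => f; rewrite !inE.
by rewrite cardsT card_ffun card_bool card_ord.
Qed.

Lemma colourings_ge E : 2 ^ n <= #|colourings E| * 2 ^ size E.
Proof.
elim: E => [|e E IHE]; first by rewrite card_colourings_nil muln1.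
by apply: leq_trans IHE _; rewrite /= expnS mulnA leq_mul2r mulnC colourings_cons_ge orbT.
Qed.

(** Acyclicity read edge by edge: each edge links two components of the edges after it and so halves
    the colourings. *)
Fixpoint forest E : bool :=
  if E is e :: E' then ~~ joined E' (source e) (target e) && forest E' else true.

Lemma colourings_forest E : forest E -> #|colourings E| * 2 ^ size E <= 2 ^ n.
Proof.
elim: E => [_|e E IHE /= /andP[sep /IHE]]; first by rewrite card_colourings_nil muln1.
by apply: leq_trans; rewrite expnS mulnA leq_mul2r mulnC colourings_cons_le ?orbT.
Qed.

Lemma colourings_gt0 E : 0 < #|colourings E|.
Proof. by apply/card_gt0P; exists [ffun=> true]; rewrite inE; apply/allP => e; rewrite !ffunE. Qed.

(** Every colouring of [E] is one of [F], because edges of [F] stay inside components of [E].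
    Comparing the lower bound 2^n for [E] with the upper bound for [F] yields the sizes. *)
Lemma forest_size_le F E : forest F ->
  (forall e, e \in F -> joined E (source e) (target e)) -> size F <= size E.
Proof.
move=> /colourings_forest leF FE; rewrite -(leq_exp2l (m := 2)) //.
have leE := leq_trans leF (colourings_ge E).
have : colourings E \subset colourings F.
  apply/subsetP => f fE; rewrite inE; apply/allP => e /FE.
  by move/(colouring_joined fE) => ->.
move/subset_leq_card; have := colourings_gt0 F; nia.
Qed.

Lemma card_colourings_connected E (u : 'I_n) :
  (forall v, joined E u v) -> #|colourings E| <= 2.
Proof.
move=> conn; rewrite -card_bool.
rewrite -(card_in_imset (f := fun f : {ffun 'I_n -> bool} => f u)) ?max_card //.
move=> f g fE gE eq_u; apply/ffunP => v.
by rewrite -(colouring_joined fE (conn v)) -(colouring_joined gE (conn v)).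
Qed.

Lemma connected_size E : (forall u v, joined E u v) -> n <= (size E).+1.
Proof.
move=> conn; have [n0|n_gt0] := posnP n; first by lia.
rewrite -(leq_exp2l (m := 2)) // expnS; apply: leq_trans (colourings_ge E) _.
by rewrite leq_mul2r (card_colourings_connected (conn (Ordinal n_gt0))) orbT.
Qed.

Lemma eq_ends e e' : [set source e; target e] = [set source e'; target e'] ->
  traverses false e' (source e) (target e).
Proof.
move/setP => eq_e; have := eq_e (source e); have := eq_e (target e).
have := eq_e (source e'); have := eq_e (target e').
rewrite !inE !eqxx !orbT /traverses /=.
rewrite ![_ == source e']eq_sym ![_ == target e']eq_sym.
by do 4!case: (_ == _).
Qed.

Lemma traverses_ends e u v : traverses false e u v -> [set u; v] = [set source e; target e].
Proof. by case/orP=> /andP[/eqP -> /eqP ->] //; rewrite setUC. Qed.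

(** A duplicate-free path in [T] between the ends of [e] would be empty for a loop, a single edge
    for a parallel edge, and otherwise close a cycle of at least three nodes with [e]. *)
Lemma acyclic_forest T : simple T -> acyclic T -> forest T.
Proof.
elim: T => //= e T IHT [/= /andP[no_loop loops] /andP[new uniq_T]] acyc.
have adj_sub u v : adjacent T u v -> adjacent (e :: T) u v by rewrite /= orbC => ->.
rewrite IHT ?andbT //; last first.
  move=> p /andP[cyc_p uniq_p]; apply: acyc; rewrite /ucycle uniq_p andbT.
  by case: p cyc_p {uniq_p} => //= x p; apply: sub_path.
apply/negP => /connectP[p path_p last_p].
case: (shortenP path_p) last_p => q path_q uniq_q _ last_q.
case: q path_q uniq_q last_q => [|y [|z q]] /= path_q uniq_q last_q.
- by rewrite last_q eqxx in no_loop.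
- case/negP: new; move: path_q; rewrite andbT -last_q => /adjacentP[e' e'T /traverses_ends ->].
  exact: map_f.
suff /acyc : ucycle (adjacent (e :: T)) [:: source e, y, z & q] by [].
apply/andP; split=> //; move: path_q => /and3P[adj1 adj2 path_q].
have path_z : path (adjacent (e :: T)) z (rcons q (source e)).
  by rewrite rcons_path (sub_path adj_sub path_q) /= -last_q /traverses !eqxx orbT.
by apply/and3P; split; [exact: adj_sub|exact: adj_sub|].
Qed.

(** * Connected edge sets of minimal size are trees *)

Section SmallConnected.

Variable T : seq (edge n W).
Hypotheses (T_conn : forall u v, joined T u v) (T_size : size T <= n.-1).

Lemma tree_edge_separates e T' : perm_eq T (e :: T') -> ~~ joined T' (source e) (target e).
Proof.
move=> permT; apply/negP => joined_e.
have conn' u v : joined T' u v.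
  apply: joined_trans_edges (T_conn u v) => e'; rewrite (perm_mem permT) inE.
  by case/predU1P=> [->|/joined_ends].
have := T_size; rewrite (perm_size permT) /= ltnNge -subn1 leq_subLR add1n.
by rewrite (connected_size conn').
Qed.

(** Neither a loop nor an edge with a parallel copy separates its ends. Unlike connectedness, the
    property that every edge separates its ends passes to tails of the list, so it carries the
    induction. *)
Lemma small_connected_simple : simple T.
Proof.
have : forall e T', perm_eq T (e :: T') -> ~~ joined T' (source e) (target e).
  exact: tree_edge_separates.
elim: T => //= e S IHS sep.
have [] := IHS.
  move=> e' S' permS; have := sep e' (e :: S').
  rewrite (perm_trans (_ : perm_eq _ (e :: e' :: S'))) ?perm_cons //; last first.
    by rewrite -[e :: _]/([:: e] ++ [:: e'] ++ S') perm_catCA.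
  by move=> /(_ isT); apply: contraNN; apply: joined_subset => x; rewrite inE orbC => ->.
have sep_e := sep e S (perm_refl _).
move=> loops uniqS; split=> /=; rewrite ?loops ?uniqS ?andbT.
  by apply: contraNneq sep_e => ->.
apply: contraNN sep_e => /mapP[e' e'S /eq_ends]; exact: joined_edge.
Qed.

(** On a cycle x, y, z, ... the edge [e] between x and y would not separate: the step from y to z
    differs from [e] because z is not x, and the way from z back to x avoids [e] because it avoids
    y. *)
Lemma small_connected_acyclic : acyclic T.
Proof.
move=> p /andP[cyc_p uniq_p]; rewrite leqNgt; apply/negP => lt_p.
case: p cyc_p uniq_p lt_p => [|x [|y [|z r]]] //= /andP[/adjacentP[e eT tr]].
move=> /andP[adj_yz path_z] /andP[x_notin /andP[y_notin uniq_z]] _.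
have eT' := perm_to_rem eT; case/negP: (tree_edge_separates eT').
have avoid a b : y != a -> y != b -> adjacent T a b -> adjacent (rem e T) a b.
  move=> ya yb /adjacentP[e' e'T tr']; apply/adjacentP; exists e' => //.
  move: e'T; rewrite (perm_mem eT') inE => /predU1P[eq_e|//].
  have /setP/(_ y) : [set a; b] = [set x; y].
    by rewrite (traverses_ends tr') eq_e (traverses_ends tr).
  by rewrite !inE (negPf ya) (negPf yb) eqxx orbT.
have yx : y != x by apply: contraNneq x_notin => ->; rewrite mem_head.
have joined_zx : joined (rem e T) z x.
  apply/connectP; exists (rcons r x); last by rewrite last_rcons.
  apply: (sub_in_path (P := predC1 y)) path_z.
    by move=> a b; rewrite !inE ![_ == y]eq_sym; apply: avoid.
  apply/allP => a; rewrite inE mem_rcons orbCA inE => /predU1P[->|a_in] /=.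
    by rewrite eq_sym.
  by apply: contraNneq y_notin => <-; rewrite inE.
have joined_yz : joined (rem e T) y z.
  have [e' e'T tr'] := adjacentP _ _ _ adj_yz; apply: (joined_edge _ tr').
  move: e'T; rewrite (perm_mem eT') inE => /predU1P[eq_e|//].
  have /setP/(_ x) : [set y; z] = [set x; y].
    by rewrite (traverses_ends tr') eq_e (traverses_ends tr).
  rewrite !inE eqxx /= => /eqP; move: x_notin; rewrite !inE !negb_or.
  by case: (x == y); case: (x == z).
have joined_yx := connect_trans joined_yz joined_zx.
by case/orP: tr => /andP[/eqP -> /eqP ->] //; rewrite joined_sym.
Qed.

End SmallConnected.

(** Layer-cake summation: a weight is the number of thresholds below it. Costs can thus be compared
    by counting light edges threshold by threshold. *)
Lemma cost_thresholds T :
  cost T = \sum_(w < W) (size T - size [seq e <- T | weight e <= w]).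
Proof.
have weightE e : weight e = \sum_(w < W) (w < weight e).
  have : \sum_(w < weight e) 1 = \sum_(w < W | w < weight e) 1.
    exact: (big_ord_widen W (fun=> 1)) (ltn_ord e.2).
  by rewrite sum_nat_const card_ord muln1 big_mkcond.
rewrite /cost (eq_bigr _ (fun e _ => weightE e)) exchange_big /=.
apply: eq_bigr => w _; rewrite -big_mkcond sum1_count size_filter.
rewrite -(count_predC (fun e => weight e <= w) T) addKn.
by apply: eq_count => e /=; rewrite ltnNge.
Qed.

Lemma simple_filter a T : simple T -> simple [seq e <- T | a e].
Proof.
case=> loops uniqT; split.
  by rewrite all_filter; apply: sub_all loops => e /= ->; rewrite implybT.
by apply: subseq_uniq uniqT; apply/map_subseq/filter_subseq.
Qed.

Lemma acyclic_filter a T : acyclic T -> acyclic [seq e <- T | a e].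
Proof.
move=> acyc p /andP[cyc_p uniq_p]; apply: acyc; rewrite /ucycle uniq_p andbT.
case: p cyc_p {uniq_p} => //= x p; apply: sub_path => u v /adjacentP[e].
by rewrite mem_filter => /andP[_ eT] tr; apply/adjacentP; exists e.
Qed.

(* For every threshold w, an acyclic set has at most as many edges of weight <= w
   as T has, because these edges of T already connect the ends of every edge of
   weight <= w. *)
Lemma min_spanning_tree_criterion E T :
  {subset T <= E} -> (forall u v, joined T u v) -> size T <= n.-1 ->
  (forall e, e \in E ->
     joined [seq e' <- T | weight e' <= weight e] (source e) (target e)) ->
  min_spanning_tree E T.
Proof.
move=> TE T_conn T_size bottleneck.
split=> [|T' [T'E T'_simple T'_acyclic T'_conn]].
  by split=> //; [apply: small_connected_simple|apply: small_connected_acyclic].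
rewrite !cost_thresholds; apply: leq_sum => w _; apply: leq_sub.
  by have := connected_size T'_conn; lia.
apply: forest_size_le.
  by apply: acyclic_forest; [apply: simple_filter|apply: acyclic_filter].
move=> e; rewrite mem_filter => /andP[le_w /T'E/bottleneck].
apply: joined_subset => e'; rewrite !mem_filter => /andP[le_e' ->]; rewrite andbT.
exact: leq_trans le_w.
Qed.

End Forests.

(** * Certificates for minimum spanning trees *)

Section SpanningTreeProtocol.

Variables (n W : nat).
Implicit Types (A T : seq (edge n W)) (e f : edge n W).

Local Notation joined E u v := (connect (adjacent E) u v).

(* An interval (l, r, g) claims that the nodes at the positions l, ..., r are
   joined by output edges of weight at most g + 1. *)
Definition interval : finType := ('I_n * 'I_n * 'I_W)%type.

Definition inside (i : 'I_n) (J : interval) : bool := J.1.1 <= i <= J.1.2.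

(* In order: a node and its position; two intervals merged by an output edge; an
   input edge and an interval around it whose claim covers its ends. *)
Definition mst_letter : finType :=
  ('I_n * 'I_n * interval + interval * interval * edge n W * 'I_n * 'I_n +
   edge n W * 'I_n * 'I_n * interval)%type.

Definition mst_ok (l : mst_letter) : bool :=
  match l with
  | inl (inl (_, _, J)) => (J.1.1 == 0 :> nat) && (J.1.2 == n.-1 :> nat)
  | inl (inr (J1, J2, e, i1, i2)) =>
      [&& J1.1.1 <= J1.1.2, J2.1.1 == J1.1.2.+1 :> nat, J2.1.1 <= J2.1.2,
          J1.2 <= e.2, J2.2 <= e.2 &
          inside i1 J1 && inside i2 J2 || inside i1 J2 && inside i2 J1]
  | inr (e, i1, i2, J) =>
      [&& inside i1 J, inside i2 J & (J.1.1 == J.1.2) || (J.2 <= e.2)]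
  end.

(** All merges share the index [inr tt], so the order merely counts them; asking for [n.-1] of them
    bounds the size of the output. *)
Definition mst_idx (l : mst_letter) : option ('I_n + unit) :=
  match l with
  | inl (inl (i, _, _)) => Some (inl i)
  | inl (inr _) => Some (inr tt)
  | inr _ => None
  end.

Definition mst_order : seq ('I_n + unit) := map inl (enum 'I_n) ++ nseq n.-1 (inr tt).

Definition mst_out (l : mst_letter) : seq (edge n W) :=
  if l is inl (inr (_, _, e, _, _)) then [:: e] else [::].

Definition mst_fact : finType := ('I_n * 'I_n + interval + edge n W)%type.

Definition at_fact (i v : 'I_n) : mst_fact := inl (inl (i, v)).
(** The claim of a one-position interval holds by itself; this is the base of the recursion over
    intervals. *)
Definition itv_facts (J : interval) : seq mst_fact :=
  if J.1.1 == J.1.2 then [::] else [:: inl (inr J)].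

Definition mst_prov (l : mst_letter) : mst_fact :=
  match l with
  | inl (inl (i, v, _)) => at_fact i v
  | inl (inr (J1, J2, e, _, _)) => inl (inr (J1.1.1, J2.1.2, e.2))
  | inr (e, _, _, _) => inr e
  end.

Definition mst_cons (l : mst_letter) : seq mst_fact :=
  match l with
  | inl (inl (_, _, J)) => itv_facts J
  | inl (inr (J1, J2, e, i1, i2)) =>
      [:: at_fact i1 (source e), at_fact i2 (target e), inr e &
          itv_facts J1 ++ itv_facts J2]
  | inr (e, i1, i2, J) =>
      [:: at_fact i1 (source e), at_fact i2 (target e) & itv_facts J]
  end.

(** Nodes do not come from the stream; having them in the left multiset forces each node to be given
    exactly one position. *)
Definition mst_base : seq (edge n W + 'I_n) := map inr (enum 'I_n).
Definition mst_keys e : seq (edge n W + 'I_n) := [:: inl e].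
Definition mst_uses (l : mst_letter) : seq (edge n W + 'I_n) :=
  match l with
  | inl (inl (_, v, _)) => [:: inr v]
  | inl (inr _) => [::]
  | inr (e, _, _, _) => [:: inl e]
  end.

Local Notation accepts := (lookup_accepts mst_ok mst_idx mst_order mst_prov mst_cons
  mst_base mst_keys mst_uses).

(** The interval of all positions gives connectedness, the number of merges bounds the number of
    edges, and the edge letters give the bottleneck condition of [min_spanning_tree_criterion]. *)
Lemma mst_sound A ls : accepts A ls -> min_spanning_tree A (flatten (map mst_out ls)).
Proof.
have shorter1 (l1 r1 l2 r2 b : nat) : l1 <= r1 -> l2 = r1.+1 -> l2 <= r2 ->
  r2 - l1 < b.+1 -> r1 - l1 < b by lia.
have shorter2 (l1 r1 l2 r2 b : nat) : l1 <= r1 -> l2 = r1.+1 -> l2 <= r2 ->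
  r2 - l1 < b.+1 -> r2 - l2 < b by lia.
have split_itv (l1 r1 l2 r2 i : nat) : l2 = r1.+1 -> l1 <= i <= r2 ->
  (l1 <= i <= r1) || (l2 <= i <= r2) by lia.
have squeeze (l i i' : nat) : l <= i <= l -> l <= i' <= l -> i = i' by lia.
move=> [/allP ok_ls ord_ls perm_ls sub_ls]; set T := flatten _.
have looked l x : l \in ls -> x \in mst_cons l -> x \in map mst_prov ls.
  by move=> l_in x_in; apply: sub_ls; apply/flatten_mapP; exists l.
(* The index of merges repeats, so uniqueness of positions is argued on the indices of node letters
   alone. *)
pose pidx (l : mst_letter) := if l is inl (inl (i, _, _)) then Some i else None.
have pidx_uniq : uniq (pmap pidx ls).
  suff -> : pmap pidx ls = enum 'I_n by apply: enum_uniq.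
  pose getl (j : 'I_n + unit) := if j is inl i then Some i else None.
  transitivity (pmap getl (pmap mst_idx ls)).
    by elim: (ls) => //= -[[[[i v] J]|[[[[J1 J2] e] i1] i2]]|[[[e i1] i2] J]] r -> //=.
  rewrite ord_ls pmap_cat (_ : pmap getl (nseq _ _) = [::]) ?cats0.
    by elim: (enum _) => //= i r ->.
  by elim: n.-1.
have at_inj i v v' : at_fact i v \in map mst_prov ls ->
    at_fact i v' \in map mst_prov ls -> v = v'.
  case/mapP => -[[[[j u] J]|[[[[J1 J2] e] i1] i2]]|[[[e i1] i2] J]] //= in1 [-> ->].
  case/mapP => -[[[[j' u'] J']|[[[[J1 J2] e] i1] i2]]|[[[e i1] i2] J']] //= in2 [eq_j ->].
  rewrite -eq_j in in2.
  by have [] := pmap_uniq_inj pidx_uniq in1 in2 erefl erefl.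
pose Tle (g : nat) := [seq e <- T | weight e <= g.+1].
have Tle_sub g1 g2 : g1 <= g2 -> {subset Tle g1 <= Tle g2}.
  move=> le_g x; rewrite !mem_filter => /andP[le1 ->]; rewrite andbT.
  by apply: leq_trans le1 _.
(* Induction on the length of the interval: the merge letter providing its claim cuts it into two
   strictly shorter intervals linked by [e], so lookups cannot be circular. *)
have itv_joined b (J : interval) i i' v v' : J.1.2 - J.1.1 < b ->
    {subset itv_facts J <= map mst_prov ls} -> inside i J -> inside i' J ->
    at_fact i v \in map mst_prov ls -> at_fact i' v' \in map mst_prov ls ->
    joined (Tle J.2) v v'.
  elim: b J i i' v v' => // b IHb [[l r] g] i i' v v' /= lt_b facts.
  rewrite /inside /= => in_i in_i' at_i at_i'.
  have [eq_lr|neq_lr] := eqVneq l r.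
    have eq_i : i = i' 
      by apply: val_inj; move: in_i in_i'; rewrite eq_lr; apply: squeeze.
    by rewrite -eq_i in at_i'; rewrite (at_inj _ _ _ at_i at_i') connect0.
  have := facts (inl (inr (l, r, g))); rewrite /itv_facts /= (negPf neq_lr) inE eqxx.
  move=> /(_ isT)/mapP[].
  move=> -[[[[j u] J]|[[[[J1 J2] e] i1] i2]]|[[[e i1] i2] J]] //= l_in [El Er Eg].
  have /= /and5P[le1 /eqP eq12 le2 leg1 /andP[leg2 ends]] := ok_ls _ l_in.
  have look x := looked _ x l_in.
  have facts1 : {subset itv_facts J1 <= map mst_prov ls}.
    by move=> x x_in; apply: look; rewrite /= !inE mem_cat x_in !orbT.
  have facts2 : {subset itv_facts J2 <= map mst_prov ls}.
    by move=> x x_in; apply: look; rewrite /= !inE mem_cat x_in !orbT.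
  have at1 : at_fact i1 (source e) \in map mst_prov ls by apply: look; rewrite !inE eqxx.
  have at2 : at_fact i2 (target e) \in map mst_prov ls.
    by apply: look; rewrite !inE eqxx !orbT.
  have e_in : e \in Tle g.
    rewrite mem_filter Eg leqnn; apply/flatten_mapP.
    by eexists; first exact: l_in; rewrite mem_head.
  have lt1 : J1.1.2 - J1.1.1 < b 
    by apply: shorter1 le1 eq12 le2 _; rewrite -El -Er.
  have lt2 : J2.1.2 - J2.1.1 < b 
    by apply: shorter2 le1 eq12 le2 _; rewrite -El -Er.
  have join1 x x' u u' : inside x J1 -> inside x' J1 ->
      at_fact x u \in map mst_prov ls -> at_fact x' u' \in map mst_prov ls ->
      joined (Tle g) u u'.
    move=> in1 in2 a1 a2; have := IHb J1 x x' u u' lt1 facts1 in1 in2 a1 a2.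
    by apply: joined_subset; apply: Tle_sub; rewrite Eg.
  have join2 x x' u u' : inside x J2 -> inside x' J2 ->
      at_fact x u \in map mst_prov ls -> at_fact x' u' \in map mst_prov ls ->
      joined (Tle g) u u'.
    move=> in1 in2 a1 a2; have := IHb J2 x x' u u' lt2 facts2 in1 in2 a1 a2.
    by apply: joined_subset; apply: Tle_sub; rewrite Eg.
  have joined_e := joined_ends e_in.
  have cross x x' u u' : inside x J1 -> inside x' J2 ->
      at_fact x u \in map mst_prov ls -> at_fact x' u' \in map mst_prov ls ->
      joined (Tle g) u u'.
    move=> in1 in2 a1 a2; case/orP: ends => /andP[in_i1 in_i2].
      apply: connect_trans (join1 _ _ _ _ in1 in_i1 a1 at1) _.
      exact: connect_trans joined_e (join2 _ _ _ _ in_i2 in2 at2 a2).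
    apply: connect_trans (join1 _ _ _ _ in1 in_i2 a1 at2) _.
    apply: connect_trans (join2 _ _ _ _ in_i1 in2 at1 a2).
    by rewrite joined_sym.
  have side (x : 'I_n) : l <= x <= r -> inside x J1 || inside x J2.
    by rewrite El Er; apply: split_itv.
  case/orP: (side _ in_i) => in1; case/orP: (side _ in_i') => in2.
  - exact: join1 in1 in2 at_i at_i'.
  - exact: cross in1 in2 at_i at_i'.
  - by rewrite joined_sym; apply: cross in2 in1 at_i' at_i.
  exact: join2 in1 in2 at_i at_i'.
have Tle_T g : {subset Tle g <= T} by move=> x; rewrite mem_filter => /andP[].
have at_some v : exists i, exists2 J, inl (inl (i, v, J)) \in ls &
    at_fact i v \in map mst_prov ls.
  have : inr v \in flatten (map mst_uses ls).
    by rewrite -(perm_mem perm_ls) mem_cat map_f ?mem_enum.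
  case/flatten_mapP => -[[[[i u] J]|[[[[J1 J2] e] i1] i2]]|[[[e i1] i2] J]] //= l_in.
  rewrite inE => /eqP[->]; exists i, J => //.
  by apply/mapP; eexists; first exact: l_in.
have uses_A e : inl e \in flatten (map mst_uses ls) = (e \in A).
  rewrite -(perm_mem perm_ls) mem_cat; case: mapP => [[] //|_] /=.
  apply/flatten_mapP/idP => [[f f_in]|e_in]; first by rewrite inE => /eqP[->].
  by exists e; rewrite // inE.
apply: min_spanning_tree_criterion.
- move=> e /flatten_mapP[]; case=> [[[[i u] J]|[[[[J1 J2] e'] i1] i2]]|[[[e' i1] i2] J]] //= l_in.
  rewrite inE => /eqP ->.
  have : inr e' \in map mst_prov ls by apply: looked l_in _; rewrite !inE eqxx !orbT.
  case/mapP => -[[[[i u] J]|[[[[? ?] f] ? ] ?]]|[[[f ?] ?] J]] //= f_in [->].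
  rewrite -uses_A; apply/flatten_mapP; eexists; first exact: f_in.
  by rewrite /= mem_head.
- move=> u v; have [i [J J_in at_i]] := at_some u; have [i' [_ _ at_i']] := at_some v.
  have /= /andP[/eqP J0 /eqP Jn] := ok_ls _ J_in.
  apply: joined_subset (Tle_T J.2) _.
  apply: (itv_joined _ J i i' u v (ltnSn _)) => //.
  + by move=> x; apply: looked J_in.
  + by rewrite /inside J0 Jn /= -ltnS; apply: leq_trans (ltn_ord i) (leqSpred _).
  by rewrite /inside J0 Jn /= -ltnS; apply: leq_trans (ltn_ord i') (leqSpred _).
- have -> : size T = count_mem (inr tt) (pmap mst_idx ls).
    rewrite /T; elim: (ls) => //= -[[[[i v] J]|[[[[J1 J2] e] i1] i2]]|[[[e i1] i2] J]] r //= ->.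
    by [].
  rewrite ord_ls count_cat count_nseq mul1n.
  by rewrite (_ : count _ _ = 0) //; elim: (enum _).
move=> e; rewrite -uses_A => /flatten_mapP[].
move=> -[[[[i u] J]|[[[[J1 J2] e'] i1] i2]]|[[[e' i1] i2] J]] //= l_in.
rewrite inE => /eqP[->].
have /= /and3P[in1 in2 le_g] := ok_ls _ l_in.
have at1 : at_fact i1 (source e') \in map mst_prov ls.
  by apply: looked l_in _; rewrite !inE eqxx.
have at2 : at_fact i2 (target e') \in map mst_prov ls.
  by apply: looked l_in _; rewrite !inE eqxx orbT.
case/orP: le_g => [/eqP eq_lr|le_g].
  have eq_i : i1 = i2.
    by apply: val_inj; move: in1 in2; rewrite /inside eq_lr; apply: squeeze.
  by rewrite -eq_i in at2; rewrite (at_inj _ _ _ at1 at2) connect0.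
apply: joined_subset (Tle_sub _ _ le_g) _.
apply: (itv_joined _ J i1 i2 _ _ (ltnSn _)) => //.
by move=> x x_in; apply: looked l_in _; rewrite !inE x_in !orbT.
Qed.

(** * Merge trees of Kruskal's algorithm *)

Inductive merge_tree := Leaf of 'I_n | Fork of merge_tree & edge n W & merge_tree.

Fixpoint leaves t : seq 'I_n :=
  match t with Leaf v => [:: v] | Fork t1 _ t2 => leaves t1 ++ leaves t2 end.

(** A leaf gets 0, below every weight, so that it satisfies each bound on tops. *)
Definition top t : nat := if t is Fork _ e _ then weight e else 0.

Definition crosses e (s1 s2 : seq 'I_n) : bool :=
  (source e \in s1) && (target e \in s2) || (source e \in s2) && (target e \in s1).

Fixpoint kruskal A t : bool :=
  if t is Fork t1 e t2 then
    [&& kruskal A t1, kruskal A t2, e \in A, crosses e (leaves t1) (leaves t2),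
        top t1 <= weight e, top t2 <= weight e &
        all (fun f => crosses f (leaves t1) (leaves t2) ==> (weight e <= weight f)) A]
  else true.

Lemma leaves_gt0 t : 0 < size (leaves t).
Proof. by elim: t => //= t1 IH1 e t2 _; rewrite size_cat ltn_addr. Qed.

Lemma has_split (S : Type) (a : pred S) s : has a s ->
  exists s1 x s2, s = s1 ++ x :: s2 /\ a x.
Proof.
elim: s => //= x s IHs; case: (boolP (a x)) => /= [ax _|_ /IHs[s1 [y [s2 [-> ay]]]]].
  by exists [::], x, s.
by exists (x :: s1), y, s2.
Qed.

Definition holds_ends e t : bool := (source e \in leaves t) && (target e \in leaves t).

(** The loop invariant of Kruskal's algorithm. Its last clause ensures that the next merging edge is
    at least as heavy as all earlier ones. *)
Definition kruskal_forest A (ts : seq merge_tree) : bool :=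
  [&& perm_eq (flatten (map leaves ts)) (enum 'I_n), all (kruskal A) ts &
      all (fun f => ~~ has (holds_ends f) ts ==>
                    all (fun t => top t <= weight f) ts) A].

(** Otherwise the leaves of the first tree would be closed under adjacency, and connectedness would
    put those of the second tree among them. *)
Lemma crossing_edge A ts : (forall u v, joined A u v) ->
  kruskal_forest A ts -> 1 < size ts -> exists2 e, e \in A & ~~ has (holds_ends e) ts.
Proof.
move=> A_conn /and3P[perm_ts _ _]; case: ts perm_ts => [|t1 [|t2 ts]] //= perm_ts _.
apply/hasP; apply: contraT => /hasPn no_cross.
have := enum_uniq 'I_n; rewrite -(perm_uniq perm_ts) cat_uniq => /and3P[_ /hasPn disj _].
have [v1 v1_in] : exists v, v \in leaves t1.
  by have := leaves_gt0 t1; case: (leaves t1) => // v s; exists v; rewrite mem_head.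
have [v2 v2_in] : exists v, v \in leaves t2.
  by have := leaves_gt0 t2; case: (leaves t2) => // v s; exists v; rewrite mem_head.
have in_rest e : has (holds_ends e) (t2 :: ts) ->
    source e \notin leaves t1 /\ target e \notin leaves t1.
  move=> has_e; suff [s_in t_in] : source e \in flatten (map leaves (t2 :: ts)) /\
      target e \in flatten (map leaves (t2 :: ts)).
    by split; apply: disj.
  elim: (t2 :: ts) has_e => //= t r IHr; rewrite !mem_cat.
  by case/orP=> [/andP[-> ->]|/IHr[-> ->]]; rewrite ?orbT.
have closed_t1 : closed (adjacent A) [in leaves t1].
  move=> x y /adjacentP[e eA tr]; have := no_cross e eA; rewrite negbK.
  rewrite /= -/(has (holds_ends e) (t2 :: ts)).
  case/orP: tr => /andP[/eqP <- /eqP <-].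
    by case/orP=> [/andP[-> ->]|/in_rest[/negPf -> /negPf ->]].
  by case/orP=> [/andP[-> ->]|/in_rest[/negPf -> /negPf ->]].
have := closed_connect closed_t1 (A_conn v1 v2); rewrite /= v1_in => /esym v2_in1.
by have := disj v2; rewrite mem_cat v2_in v2_in1 => /(_ isT).
Qed.

(** Two trees are merged along a lightest edge not contained in one tree. Edges that still run
    between trees afterwards did so before, so they are at least as heavy and the invariant
    survives. *)
Lemma kruskal_merge A ts : (forall u v, joined A u v) ->
  kruskal_forest A ts -> 1 < size ts ->
  exists2 ts', kruskal_forest A ts' & (size ts').+1 = size ts.
Proof.
move=> A_conn forest_ts gt1.
have [e0 e0A cross0] := crossing_edge A_conn forest_ts gt1.
have [e [eA cross_e] min_e] := @exists_min_nat _
  (fun e => e \in A /\ ~~ has (holds_ends e) ts) (@weight n W)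
  (ex_intro _ e0 (conj e0A cross0)).
case/and3P: forest_ts => perm_ts kr_ts /allP top_ts.
have in_some v : has (fun t => v \in leaves t) ts.
  have : v \in flatten (map leaves ts) by rewrite (perm_mem perm_ts) mem_enum.
  by elim: (ts) => //= t r IHr; rewrite mem_cat => /orP[->|/IHr ->]; rewrite ?orbT.
have [s1 [ta [s2 [eq_ts src_a]]]] := has_split (in_some (source e)).
have : has (fun t => target e \in leaves t) (s1 ++ s2).
  have := in_some (target e); rewrite eq_ts !has_cat /=.
  have : ~~ holds_ends e ta.
    by apply: contra cross_e; rewrite eq_ts has_cat /= => ->; rewrite orbT.
  by rewrite /holds_ends src_a /= => /negPf ->.
case/has_split => s3 [tb [s4 [eq_s tgt_b]]].
have all_ts a : all a ts = [&& a ta, a tb & all a (s3 ++ s4)].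
  rewrite eq_ts all_cat /= andbCA -all_cat eq_s !all_cat /=.
  by congr (_ && _); rewrite andbCA.
have has_ts a : has a ts = [|| a ta, a tb | has a (s3 ++ s4)].
  rewrite eq_ts has_cat /= orbCA -has_cat eq_s !has_cat /=.
  by congr (_ || _); rewrite orbCA.
have perm_merge : perm_eq (flatten (map leaves ts))
    (leaves ta ++ leaves tb ++ flatten (map leaves (s3 ++ s4))).
  apply/permP => a; rewrite eq_ts map_cat flatten_cat /= !count_cat.
  have := congr1 (fun s => count a (flatten (map leaves s))) eq_s.
  by rewrite !map_cat !flatten_cat /= !count_cat; lia.
have := enum_uniq 'I_n; rewrite -(perm_uniq perm_ts) (perm_uniq perm_merge).
rewrite cat_uniq has_cat negb_or => /and3P[_ /andP[/hasPn disj_ab /hasPn disj_a]].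
rewrite cat_uniq => /and3P[_ /hasPn disj_b _].
(* Leaf lists of different trees are disjoint, so an edge between [ta] and [tb] lies in no tree and
   is subject to the minimality of [e]. *)
have crosses_split f : crosses f (leaves ta) (leaves tb) -> ~~ has (holds_ends f) ts.
  have in_flat v r : v \notin flatten (map leaves r) -> ~~ has (fun t => v \in leaves t) r.
    by elim: r => //= t r IHr; rewrite mem_cat !negb_or => /andP[-> /IHr].
  have not_both v : v \in leaves ta -> v \in leaves tb -> False.
    by move=> v_a /disj_ab; rewrite v_a.
  have not_rest v : (v \in leaves ta) || (v \in leaves tb) ->
      ~~ has (fun t => v \in leaves t) (s3 ++ s4).
    move=> v_in; apply/in_flat; apply: contraTN v_in => v_in.
    by rewrite negb_or disj_a // disj_b.
  move=> cr; rewrite has_ts !negb_or; apply/and3P; split.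
  - apply/negP => /andP[s_a t_a]; case/orP: cr => /andP[s_in t_in].
      exact: not_both t_a t_in.
    exact: not_both s_a s_in.
  - apply/negP => /andP[s_b t_b]; case/orP: cr => /andP[s_in t_in].
      exact: not_both s_in s_b.
    exact: not_both t_in t_b.
  have : ~~ has (fun t => source f \in leaves t) (s3 ++ s4).
    by apply: not_rest; case/orP: cr => /andP[-> _]; rewrite ?orbT.
  by apply: contraNN; apply: sub_has => t /andP[].
have top_e : all (fun t => top t <= weight e) ts by apply: (implyP (top_ts e eA)).
exists (Fork ta e tb :: s3 ++ s4); last first.
  have := congr1 size eq_s; rewrite eq_ts /= !size_cat /=; lia.
apply/and3P; split.
- by rewrite /= -catA; apply: perm_trans perm_ts; rewrite perm_sym.
- move: kr_ts top_e; rewrite !all_ts => /and3P[kr_a kr_b kr_r] /and3P[top_a top_b _].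
  rewrite /= kr_a kr_b kr_r eA top_a top_b /crosses src_a tgt_b /= andbT.
  apply/allP => f fA; apply/implyP => /crosses_split cross_f.
  by apply: min_e.
apply/allP => f fA; apply/implyP => no_f.
have cross_f : ~~ has (holds_ends f) ts.
  apply: contra no_f; rewrite has_ts /= /holds_ends !mem_cat.
  by case/or3P=> [/andP[-> ->]|/andP[-> ->]|->]; rewrite ?orbT.
have := implyP (top_ts f fA) cross_f; rewrite all_ts => /and3P[_ _ top_r].
by rewrite /= min_e.
Qed.

Lemma kruskal_tree_exists A : 0 < n -> (forall u v, joined A u v) ->
  exists2 t, kruskal A t & perm_eq (leaves t) (enum 'I_n).
Proof.
move=> n_gt0 A_conn.
have start : kruskal_forest A (map Leaf (enum 'I_n)).
  apply/and3P; split; first by rewrite -map_comp flatten_seq1.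
    by rewrite all_map; apply/allP.
  by apply/allP => f _; apply/implyP => _; rewrite all_map; apply/allP.
have [k] := ubnP (size (map Leaf (enum 'I_n))).
have : 0 < size (map Leaf (enum 'I_n)) by rewrite size_map size_enum_ord.
elim: k (map _ _) start => // k IHk [|t [|t' ts]] // forest_ts _ lt_k.
  case/and3P: forest_ts => /=; rewrite cats0 andbT => perm_t kr_t _.
  by exists t.
have [ts' forest_ts' sz] := kruskal_merge A_conn forest_ts isT.
by apply: IHk forest_ts' _ _; move: sz lt_k => /=; lia.
Qed.

(** * The certificate read off a merge tree *)

Section Certificate.

Variables (A : seq (edge n W)) (v0 : 'I_n) (w0 : 'I_W) (t : merge_tree).
Hypotheses (w0_0 : w0 = 0 :> nat) (t_kruskal : kruskal A t).
Hypothesis t_leaves : perm_eq (leaves t) (enum 'I_n).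

Definition place (k : nat) : 'I_n := insubd v0 k.
Definition position v : 'I_n := place (index v (leaves t)).

Definition top_index t' : 'I_W := if t' is Fork _ e _ then e.2 else w0.
(** [o] is the number of leaves to the left of the subtree, whose own leaves then occupy consecutive
    positions from [o] on. *)
Definition tree_interval o t' : interval :=
  (place o, place (o + size (leaves t')).-1, top_index t').

Fixpoint fork_letters o t' : seq mst_letter :=
  if t' is Fork t1 e t2 then
    inl (inr (tree_interval o t1, tree_interval (o + size (leaves t1)) t2, e,
              position (source e), position (target e))) ::
    fork_letters o t1 ++ fork_letters (o + size (leaves t1)) t2
  else [::].

Definition placed o t' : Prop :=
  [/\ uniq (leaves t'), o + size (leaves t') <= n &
      forall v, v \in leaves t' -> position v = o + index v (leaves t') :> nat].

Lemma placeK k : k < n -> place k = k :> nat.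
Proof. by move=> lt_k; rewrite /place val_insubd lt_k. Qed.

Lemma placed_root : placed 0 t.
Proof.
have sz : size (leaves t) = n by rewrite (perm_size t_leaves) size_enum_ord.
split; [by rewrite (perm_uniq t_leaves) enum_uniq|by rewrite sz|move=> v v_in].
by rewrite placeK // -[X in _ < X]sz index_mem.
Qed.

Lemma placed_fork o t1 e t2 : placed o (Fork t1 e t2) ->
  placed o t1 /\ placed (o + size (leaves t1)) t2.
Proof.
case=> /=; rewrite cat_uniq size_cat => /and3P[uniq1 /hasPn disj uniq2] le_n pos.
split; split=> //.
- by lia.
- by move=> v v_in; rewrite pos ?mem_cat ?v_in // index_cat v_in.
- by rewrite -addnA.
by move=> v v_in; rewrite pos ?mem_cat ?v_in ?orbT // index_cat (negPf (disj v v_in)) addnA.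
Qed.

Lemma last_placed o t' : placed o t' ->
  place (o + size (leaves t')).-1 = (o + size (leaves t')).-1 :> nat.
Proof. by case=> _ le_n _; have := leaves_gt0 t' => gt0; rewrite placeK //; lia. Qed.

Lemma first_placed o t' : placed o t' -> place o = o :> nat.
Proof. by case=> _ le_n _; have := leaves_gt0 t' => gt0; rewrite placeK //; lia. Qed.

Lemma inside_placed o t' v : placed o t' -> v \in leaves t' ->
  inside (position v) (tree_interval o t').
Proof.
move=> pl v_in; rewrite /inside /= (last_placed pl) (first_placed pl).
case: pl => _ _ /(_ v v_in) ->; rewrite leq_addr /=.
by rewrite -ltnS prednK ?addn_gt0 ?leaves_gt0 ?orbT // ltn_add2l index_mem.
Qed.

Lemma top_index_le t' e : top t' <= weight e -> top_index t' <= e.2.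
Proof. by case: t' => [v|t1 e' t2] /=; rewrite ?w0_0. Qed.

Lemma fork_letters_ok o t' : placed o t' -> kruskal A t' ->
  all mst_ok (fork_letters o t').
Proof.
elim: t' o => //= t1 IH1 e t2 IH2 o pl.
case/and5P=> kr1 kr2 eA cr /and3P[top1 top2 _].
have [pl1 pl2] := placed_fork pl.
rewrite all_cat IH1 // IH2 // !andbT !top_index_le //=.
rewrite (first_placed pl1) (last_placed pl1) (first_placed pl2) (last_placed pl2).
have := leaves_gt0 t1; have := leaves_gt0 t2 => gt2 gt1.
apply/and4P; split; [by lia|by apply/eqP; lia|by lia|].
by case/orP: cr => /andP[src tgt]; rewrite !(inside_placed _ src) ?(inside_placed _ tgt) ?orbT.
Qed.

Lemma itv_facts_provided o t' : placed o t' ->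
  {subset itv_facts (tree_interval o t') <= map mst_prov (fork_letters o t')}.
Proof.
case: t' => [v|t1 e t2] pl x; rewrite /itv_facts /=; first by rewrite addn1 eqxx.
case: ifP => // _; rewrite !inE => /eqP ->.
by rewrite /tree_interval /= size_cat addnA eqxx.
Qed.

Lemma fork_letters_cons o t' x : placed o t' -> kruskal A t' ->
  x \in flatten (map mst_cons (fork_letters o t')) ->
  [\/ exists v, x = at_fact (position v) v, exists2 e, e \in A & x = inr e |
      x \in map mst_prov (fork_letters o t')].
Proof.
elim: t' o => //= t1 IH1 e t2 IH2 o pl.
case/and5P=> kr1 kr2 eA _ _; have [pl1 pl2] := placed_fork pl.
rewrite !inE !map_cat flatten_cat !mem_cat.
case/or4P=> [/eqP ->|/eqP ->|/eqP ->|].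
- by constructor 1; exists (source e).
- by constructor 1; exists (target e).
- by constructor 2; exists e.
case/or3P=> [|/(IH1 _ pl1 kr1)[?|?|->]|/(IH2 _ pl2 kr2)[?|?|->]].
- by case/orP=> /itv_facts_provided -> //; constructor 3; rewrite ?orbT.
- by constructor 1.
- by constructor 2.
- by constructor 3; rewrite orbT.
- by constructor 1.
- by constructor 2.
by constructor 3; rewrite !orbT.
Qed.

Lemma fork_letters_idx o t' :
  pmap mst_idx (fork_letters o t') = nseq (size (leaves t')).-1 (inr tt).
Proof.
elim: t' o => //= t1 IH1 e t2 IH2 o; rewrite pmap_cat IH1 IH2 size_cat.
have := leaves_gt0 t1; have := leaves_gt0 t2.
by case: (size _) => // k2 _; case: (size _) => // k1 _; rewrite addnS /= nseqD.
Qed.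

Lemma fork_letters_uses o t' : flatten (map mst_uses (fork_letters o t')) = [::].
Proof. by elim: t' o => //= t1 IH1 e t2 IH2 o; rewrite map_cat flatten_cat IH1 IH2. Qed.

(** The certifying interval belongs to the lowest subtree holding both ends: there [f] runs between
    the two sides, so the fork's edge is no heavier. Descending as far as a leaf means that [f] is a
    loop. *)
Lemma edge_interval o t' f : placed o t' -> kruskal A t' -> f \in A ->
  source f \in leaves t' -> target f \in leaves t' ->
  exists J, mst_ok (inr (f, position (source f), position (target f), J)) /\
    {subset itv_facts J <= map mst_prov (fork_letters o t')}.
Proof.
elim: t' o => [v|t1 IH1 e t2 IH2] o pl kr fA src tgt.
  exists (tree_interval o (Leaf v)); rewrite /= !(inside_placed pl) //.
  by split; [rewrite addn1 eqxx|apply: (itv_facts_provided pl)].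
have [pl1 pl2] := placed_fork pl; case/and5P: (kr) => kr1 kr2 _ _ /and3P[_ _ /allP min_e].
have here : crosses f (leaves t1) (leaves t2) ->
    exists J, mst_ok (inr (f, position (source f), position (target f), J)) /\
      {subset itv_facts J <= map mst_prov (fork_letters o (Fork t1 e t2))}.
  move=> cr; exists (tree_interval o (Fork t1 e t2)); split; last exact: itv_facts_provided.
  by rewrite /mst_ok !(inside_placed pl) //=; apply/orP; right; apply: (implyP (min_e f fA)).
move: src tgt; rewrite /= !mem_cat => /orP[src|src] /orP[tgt|tgt].
- have [J [okJ facts]] := IH1 _ pl1 kr1 fA src tgt; exists J; split=> // x /facts.
  by rewrite inE map_cat mem_cat => ->; rewrite orbT.
- by apply: here; rewrite /crosses src tgt.
- by apply: here; rewrite /crosses src tgt orbT.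
have [J [okJ facts]] := IH2 _ pl2 kr2 fA src tgt; exists J; split=> // x /facts.
by rewrite inE map_cat mem_cat => ->; rewrite !orbT.
Qed.

Lemma mst_certificate : exists2 ls, accepts A ls & size ls = n + n.-1 + size A.
Proof.
have sz : size (leaves t) = n by rewrite (perm_size t_leaves) size_enum_ord.
have in_leaves v : v \in leaves t by rewrite (perm_mem t_leaves) mem_enum.
have pl := placed_root.
have /choice[itv itvP] : forall f, exists J, f \in A ->
    mst_ok (inr (f, position (source f), position (target f), J)) /\
    {subset itv_facts J <= map mst_prov (fork_letters 0 t)}.
  move=> f; have [fA|_] := boolP (f \in A); last by exists (v0, v0, w0).
  by have [J] := edge_interval pl t_kruskal fA (in_leaves _) (in_leaves _); exists J.
(* The default [i] of [nth] is never reached, as there are exactly [n] leaves. *)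
pose nodes : seq mst_letter :=
  map (fun i => inl (inl (i, nth i (leaves t) i, tree_interval 0 t))) (enum 'I_n).
pose edges : seq mst_letter :=
  [seq inr (f, position (source f), position (target f), itv f) | f <- A].
exists (nodes ++ fork_letters 0 t ++ edges); last first.
  rewrite !size_cat /nodes /edges size_map size_enum_ord size_map addnA; congr (_ + _ + _).
  have -> : size (fork_letters 0 t) = size (pmap mst_idx (fork_letters 0 t)).
    by elim: (t) (0) => //= t1 IH1 e t2 IH2 o; rewrite pmap_cat !size_cat -IH1 -IH2.
  by rewrite fork_letters_idx size_nseq sz.
have prov_forks x : x \in map mst_prov (fork_letters 0 t) ->
    x \in map mst_prov (nodes ++ fork_letters 0 t ++ edges).
  by move=> x_in; rewrite !map_cat !mem_cat x_in orbT.
have prov_at v : at_fact (position v) v \in map mst_prov (nodes ++ fork_letters 0 t ++ edges).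
  rewrite map_cat mem_cat; apply/orP; left; apply/mapP.
  exists (inl (inl (position v, v, tree_interval 0 t))) => //.
  apply/mapP; exists (position v); rewrite ?mem_enum //; congr (inl (inl (_, _, _))).
  by have [_ _ ->] := pl; rewrite ?add0n ?nth_index.
have prov_edge e : e \in A -> inr e \in map mst_prov (nodes ++ fork_letters 0 t ++ edges).
  move=> eA; rewrite !map_cat !mem_cat; apply/orP; right; apply/orP; right.
  by rewrite -map_comp; apply/mapP; exists e.
have n_gt0 : 0 < n by apply: leq_ltn_trans (ltn_ord v0).
split.
- rewrite !all_cat fork_letters_ok //= !all_map; apply/andP; split; apply/allP => z.
    move=> _ /=; rewrite (first_placed pl) (last_placed pl) add0n sz.
    by rewrite !eqxx.
  by case/itvP.
- rewrite !pmap_cat fork_letters_idx sz.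
  have -> : pmap mst_idx nodes = map inl (enum 'I_n).
    by rewrite /nodes; elim: (enum _) => //= i r ->.
  have -> : pmap mst_idx edges = [::] by rewrite /edges; elim: (A).
  by rewrite cats0.
- rewrite !map_cat !flatten_cat fork_letters_uses; apply: perm_cat.
    have -> : flatten (map mst_uses nodes) =
        map inr (map (fun i : 'I_n => nth i (leaves t) i) (enum 'I_n)).
      by rewrite /nodes; elim: (enum _) => //= i r ->.
    apply: perm_map; rewrite perm_sym; apply: perm_trans t_leaves.
    rewrite (_ : map _ _ = leaves t) //; apply: (@eq_from_nth _ v0).
      by rewrite size_map size_enum_ord.
    move=> k; rewrite size_map size_enum_ord => lt_k.
    rewrite (nth_map v0) ?size_enum_ord // nth_enum_ord //.
    by apply: set_nth_default; rewrite sz.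
  rewrite /edges /=; elim: (A) => //= e r IHr.
  by rewrite perm_cons.
move: prov_forks prov_at prov_edge.
set facts := map mst_prov (nodes ++ _) => prov_forks prov_at prov_edge x.
rewrite !map_cat !flatten_cat !mem_cat => /or3P[|x_in|].
- by case/flatten_mapP => _ /mapP[i _ ->] /= /(itv_facts_provided pl)/prov_forks.
- by have [[v ->]|[e eA ->]|] := fork_letters_cons pl t_kruskal x_in; auto.
case/flatten_mapP => _ /mapP[f fA ->] /=; rewrite !inE.
have [_ itv_sub] := itvP f fA.
by case/or3P=> [/eqP ->|/eqP ->|/itv_sub/prov_forks].
Qed.

End Certificate.

(** The given answer [o] serves only to show that the graph is connected; the certificate may output
    another minimum tree. Connectedness gives n <= m + 1 for m input edges, hence at most 3m + 1
    letters. The case n = 0 is apart because the certificate needs a node as default. *)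
Lemma mst_complete A o : 0 < W -> min_spanning_tree A o ->
  exists2 ls, accepts A ls & size ls <= 3 * size A + 1.
Proof.
move=> W_gt0 [[o_A _ _ o_conn] _].
have A_conn u v : joined A u v by apply: joined_subset o_A (o_conn u v).
have := connected_size A_conn; have [n0|n_gt0] := posnP n.
  have ord_nil : enum 'I_n = [::] by apply: size0nil; rewrite size_enum_ord.
  have A_nil : A = [::].
    by case: (A) => // e r; have := ltn_ord (source e); rewrite [X in _ < X]n0.
  move=> _; exists [::] => //; split=> //.
    by rewrite /mst_order ord_nil (_ : n.-1 = 0) // n0.
  by rewrite A_nil /mst_base ord_nil.
have [t kr_t perm_t] := kruskal_tree_exists n_gt0 A_conn.
have [ls acc_ls sz_ls] := mst_certificate (Ordinal n_gt0) (w0 := Ordinal W_gt0) erefl kr_t perm_t.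
by exists ls; rewrite // sz_ls; lia.
Qed.

End SpanningTreeProtocol.

(** * Constants and final costs *)

Lemma mst_protocol (c n m : nat) C :
  n <= poly_bound c m -> 20 * (11 * c + 3) + 57 <= C ->
  exists V : verifier m (edge n (poly_bound c m)) (edge n (poly_bound c m)),
    hv_protocol C V (@mst_problem n (poly_bound c m) m) m 1.
Proof.
(* Intervals and edges take exponent 3c each, so merge letters, the most numerous, take 11c, and the
   two sums of kinds add 2. The exponent is at least 3 so that 4(m + 2) fits below the power. *)
set W := poly_bound c m; set a := 11 * c + 3 => le_n le_C.
have W_gt0 : 0 < W by rewrite expn_gt0; lia.
have le_pow k : k <= a -> (m + 2) ^ k <= (m + 2) ^ a by move=> ?; apply: leq_pexp2l => //; lia.
have card_n : #|'I_n| <= (m + 2) ^ c by apply: card_ord_pow.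
have card_W : #|'I_W| <= (m + 2) ^ c by apply: card_ord_pow.
have card_e := card_prod_pow (card_prod_pow card_n card_n) card_W.
have card_pos := card_prod_pow (card_prod_pow card_n card_n) card_e.
have card_fork := card_prod_pow (card_prod_pow (card_prod_pow (card_prod_pow card_e card_e)
  card_e) card_n) card_n.
have card_edges := card_prod_pow (card_prod_pow (card_prod_pow card_e card_n) card_n) card_e.
have le3 : 4 * (m + 2) <= (m + 2) ^ 3.
  by rewrite !expnS expn0 muln1 mulnA leq_mul2r; apply/orP; right; nia.
have lea : 4 * (m + 2) <= (m + 2) ^ a by apply: leq_trans le3 (le_pow _ _); rewrite /a; lia.
apply: (@lookup_protocol m _ _ (@mst_problem n W m) (mst_letter n W) (mst_fact n W)
  (edge n W + 'I_n)%type _ (@mst_ok n W) (@mst_idx n W) (mst_order n) (@mst_out n W)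
  (@mst_prov n W) (@mst_cons n W) (mst_base n W) (@mst_keys n W) (@mst_uses n W)
  a (3 * m + 1) C m) => //.
- have le1 : c + c + (c + c + c) <= 11 * c by lia.
  have le2 : c + c + c + (c + c + c) + (c + c + c) + c + c <= 11 * c by lia.
  have le3' : c + c + c + c + c + (c + c + c) <= (11 * c).+1 by lia.
  apply: card_weaken (card_sum_pow (card_sum_pow (card_weaken card_pos le1)
    (card_weaken card_fork le2)) (card_weaken card_edges le3')) _.
  by rewrite /a; lia.
- rewrite size_map size_enum_ord; apply: leq_trans le_n (le_pow _ _); rewrite /a; lia.
- by move=> e; apply: leq_trans lea; rewrite /=; lia.
- case=> [[[[i v] J]|[[[[J1 J2] e] i1] i2]]|[[[e i1] i2] J]]; rewrite /= ?size_cat /itv_facts;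
    by do ?case: ifP.
- by move=> A ls; apply: mst_sound.
- move=> A o /(mst_complete W_gt0)[ls acc_ls le_ls]; exists ls => //.
  by rewrite size_tuple in le_ls.
- by move: lea; lia.
by move: le_C; nia.
Qed.

(* c bounds the degree of the polynomials in m that bound the number of nodes and
   the weights; the constants C may depend on c, and on nothing else.
   The bound m <= n ^ 2 holds for every graph without repeated edges. *)
Theorem theorem6 (c : nat) :
  [/\ exists C : nat, forall n m : nat, n <= poly_bound c m ->
        exists V : verifier m (edge n (poly_bound c m)) (edge n (poly_bound c m)),
          hv_protocol C V (@mst_problem n (poly_bound c m) m) m 1,
      forall directed : bool,
      exists C : nat, forall n m : nat, n <= poly_bound c m -> forall s : 'I_n,
        exists V : verifier m (edge n (poly_bound c m)) (sp_entry n),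
          hv_protocol C V (@sssp_problem n (poly_bound c m) directed m s)
            (m + n * up_log 2 n) 1
    & forall directed : bool,
      exists C : nat, forall n m : nat, n <= poly_bound c m -> m <= n ^ 2 ->
        exists V : verifier m (edge n (poly_bound c m)) (sp_entry n),
          hv_protocol C V (@apsp_problem n (poly_bound c m) directed m)
            (n ^ 3) 1].
Proof.
split=> [|directed|directed].
- by exists (20 * (11 * c + 3) + 57) => n m le_n; apply: mst_protocol.
- exists (20 * (10 * c + 5) + 57) => n m le_n s; rewrite sssp_problemE.
  apply: sp_protocol => //=.
  (* For n > 1 the logarithm is at least 1 and n log n covers the table; for n at most 1 the added 1
     in the help cost covers it. *)
  have [n_gt1|n_le1] := ltnP 1 n; last by lia.
  have : 0 < up_log 2 n by rewrite up_log_gt0.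
  by nia.
exists (20 * (10 * c + 5) + 57) => n m le_n le_m; rewrite apsp_problemE.
apply: sp_protocol; rewrite ?enum_uniq ?size_enum_ord //.
(* The annotation has n(n + m) letters; with m at most n^2 this is at most 2 n^3. *)
have : n * n <= n ^ 3 by rewrite !expnS expn0 muln1; nia.
have : n * m <= n ^ 3 by rewrite expnS leq_mul2l le_m orbT.
by nia.
Qed.
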